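(* For every $n=1,2,\dots$, let $M_{1,n}=(C_{i,j})_{i,j=1,\dots,n}$ be the $n\times n$ random matrix of tile areas associated with the records $r_1,r_2,\dots,r_{n+1}$ of the planar Poisson process, and let $M_{1,n}^{\star}$ be the matrix obtained by reflecting $M_{1,n}$ about the antidiagonal, that is, by exchanging each entry $(i,j)$ with entry $(n-j+1,n-i+1)$. Then $$M_{1,n}^{\star}\stackrel{d}{=}M_{1,n},$$ where $\stackrel{d}{=}$ denotes equality of the joint distributions of all matrix entries.
   Context: Let $\mathcal P$ be the planar Poisson point process with unit intensity (Lebesgue measure) in $\mathbb R_+^2$ (the positive quadrant), regarded as a random set of points (atoms) $(t,x)$; the first coordinate $t$ is called time and the second coordinate $x$ is called value. Almost surely no two atoms lie on the same vertical or horizontal line. For $a,b\in\mathbb R_+^2$, $a\nearrow b$ means that $b$ is strictly north-east of $a$ (both coordinates of $b$ are strictly larger), and $a\searrow b$ means that $b$ is strictly south-east of $a$ (larger $t$, smaller $x$). An atom $r\in\mathcal P$ is a (lower) record if there is no $a\in\mathcal P$ with $a\nearrow r$. The records, ordered by increasing time, form almost surely a two-sided infinite chain $\dots\searrow r_{-1}\searrow r_0\searrow r_1\searrow r_2\searrow\dots$, labelled by the integers so that $r_0$ and $r_1$ are separated by the line $t=x$ (that is, $r_1$ is the first record, in the order of time, whose time coordinate exceeds its value coordinate). Vertical lines through all records and horizontal lines through all records divide the positive quadrant into rectangular tiles. For integers $i,j$, $C_{i,j}$ is the area of the tile whose north-west corner is the intersection point of the horizontal line through $r_i$ and the vertical line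 through $r_j$; i.e. if $r_k=(t_k,x_k)$, then $C_{i,j}=(x_i-x_{i+1})(t_{j+1}-t_j)$. *)

(* Defs.v *)
From mathcomp Require Export all_boot all_order all_algebra.
From mathcomp Require Export all_classical all_reals all_analysis measurable_realfun.
Export Order.TTheory GRing.Theory Num.Theory.
Export numFieldNormedType.Exports.

Set Implicit Arguments.
Unset Strict Implicit.
Unset Printing Implicit Defensive.

Local Open Scope classical_set_scope.
Local Open Scope ring_scope.

Section PointConfigurations.
Context {R : realType}.
Implicit Types (a b : R * R) (A : set (R * R)).

Definition quadrant : set (R * R) := [set a | 0 <= a.1 /\ 0 <= a.2].

Definition north_east a b : bool := (a.1 < b.1) && (a.2 < b.2).

Definition south_east a b : bool := (a.1 < b.1) && (b.2 < a.2).

Definition records A : set (R * R) :=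
  [set r | A r /\ ~ exists2 a, A a & north_east a r].

(* The first coordinate of an atom is its time, the second its value: the last
   conjunct says that r 0 and r 1 are separated by the line t = x. *)
Definition records_labelling A (r : int -> R * R) : Prop :=
  [/\ range r = records A,
      forall k : int, south_east (r k) (r (k + 1)) &
      (r 0).1 <= (r 0).2 /\ (r 1).2 < (r 1).1].

Definition tile_area (r : int -> R * R) (i j : int) : R :=
  ((r i).2 - (r (i + 1)).2) * ((r (j + 1)).1 - (r j).1).

(* Matrix indices start at 0 in MathComp, so that the (i, j) entry is the area
   of the tile of index (i + 1, j + 1). *)
Definition tile_matrix n (r : int -> R * R) : 'M[R]_n :=
  \matrix_(i < n, j < n) tile_area r i.+1%:Z j.+1%:Z.

Definition antitranspose n (M : 'M[R]_n) : 'M[R]_n :=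
  \matrix_(i < n, j < n) M (rev_ord j) (rev_ord i).

End PointConfigurations.

Section RandomObjects.
Context d (T : measurableType d) (R : realType) (P : probability T R).

Definition area : set (R * R) -> \bar R :=
  (@lebesgue_measure R \x @lebesgue_measure R)%E.

Definition atom_count (N : T -> set (R * R)) (B : set (R * R)) (w : T) : \bar R :=
  counting (N w `&` B).

(* Poisson point process of unit intensity on the quadrant, seen as a random
   set of atoms. Sets of infinite area need no separate clause: their counts
   are determined by exhaustion with sets of finite area. The Poisson weights
   are spelled out because [poisson_pmf] is constantly 1 at rate 0. *)
Record poisson_process (N : T -> set (R * R)) : Prop := PoissonProcess {
  poisson_sub : forall w, N w `<=` quadrant ;
  poisson_measurable : forall B : set (R * R), measurable B ->
    measurable_fun [set: T] (atom_count N B) ;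
  poisson_law : forall B : set (R * R), measurable B -> B `<=` quadrant ->
    (area B < +oo)%E -> forall k : nat,
    P (atom_count N B @^-1` [set k%:R%:E]) =
      (fine (area B) ^+ k / k`!%:R * expR (- fine (area B)))%:E ;
  poisson_independent : forall m (B : 'I_m -> set (R * R)),
    (forall i, measurable (B i)) -> trivIset [set: 'I_m] B ->
    forall D : 'I_m -> set (\bar R), (forall i, measurable (D i)) ->
    P (\bigcap_(i in [set: 'I_m]) (atom_count N (B i) @^-1` D i)) =
      (\prod_(i < m) P (atom_count N (B i) @^-1` D i))%E }.

(* Product (Borel) sigma-algebra on matrices: the one generated by the entries. *)
Definition measurable_mx m n : set (set 'M[R]_(m, n)) :=
  <<s [set E | exists i j, exists2 B : set R,
         measurable B & E = [set M : 'M[R]_(m, n) | B (M i j)]] >>.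

Definition eq_in_law m n (X Y : T -> 'M[R]_(m, n)) : Prop :=
  forall E, @measurable_mx m n E -> P (X @^-1` E) = P (Y @^-1` E).

End RandomObjects.

(* Main.v *)
From HB Require Import structures.
Require Import Defs.
From mathcomp Require Import ring lra zify.
From mathcomp Require finmap.

Set Implicit Arguments.
Unset Strict Implicit.
Unset Printing Implicit Defensive.

Local Open Scope classical_set_scope.
Local Open Scope ring_scope.

(** Write r_k = (t_k, x_k). Given r_0, ..., r_k with k >= 1, the strip below x_k to
    the right of t_k has not been explored, so the next record appears after an
    exponential time with rate x_k, at a height uniform on [0, x_k]. In other words
    E_k = x_k (t_(k+1) - t_k) and U_k = x_(k+1) / x_k are a unit exponential and a
    uniform variable, independent of each other and of r_0, ..., r_k
    ([increment_independent]). The tile areas C_(i,j) = (x_i - x_(i+1)) E_j / x_j,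
    for i, j >= 1, depend on these increments only.

    Let W_1 be a unit exponential variable independent of everything, and let
    V_k = W_k + E_k and W_(k+1) = U_k V_k. The density of
    (W_1, V_1, W_2, ..., V_n, W_(n+1)) is
    exp (W_2 + ... + W_n - V_1 - ... - V_n) / (V_1 ... V_n) on the sequences where
    each V exceeds the neighbouring W. It is invariant under reversal of the
    sequence, hence the sequence has the same law as the reversed one
    ([levels_reversible]). The ratios W_(k+1) / V_k and V_k / W_k are
    x_(k+1) / x_k and, once all times are translated so that t_1 x_1 = W_1,
    t_(k+1) / t_k. So the matrix of tile areas is a function of the sequence.
    Reversing the sequence exchanges times and values and reverses the order of
    the records, which reflects the matrix about its antidiagonal
    ([level_tile_rev]). The theorem follows.

    Both identities of laws, the one that expresses the Markov property and the
    one that expresses reversibility, are obtained from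
    [eq_law_of_box_dominated]. Two random vectors whose coordinates satisfy the
    same strict inequalities have the same law if the probabilities that they lie
    in a small box, on which these inequalities hold, agree up to a factor close to
    1: cutting boxes into smaller ones makes the factor disappear. For the
    records such estimates come directly from the Poisson counts
    ([records_in_cells_le], [records_in_cells_ge]). The event that r_0, ..., r_m
    lie in given small cells is squeezed between two events on counts in disjoint
    sets: at least one atom in each cell and none safely below the staircase, or
    exactly one atom in each cell and none elsewhere in a slightly larger region.
    For the levels the estimates follow from the independence of the
    increments. *)

(** * Measures of finite unions, vectors and boxes *)

Section MeasureGeneralities.
Context d (T : measurableType d) (R : realType).

Lemma le_measure_ae (mu : {measure set T -> \bar R}) (A B : set T) :
  measurable A -> measurable B -> {ae mu, forall w, A w -> B w} ->
  (mu A <= mu B)%E.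
Proof.
move=> mA mB [C [mC C0 ABC]].
apply: (@le_trans _ _ (mu (B `|` C))).
  apply: le_measure; rewrite ?inE//; first exact: measurableU.
  move=> w Aw; have [Bw|nBw] := pselect (B w); [by left|right].
  by apply: ABC => /= AB; exact/nBw/AB.
by rewrite (le_trans (measureU2 _ _ _))//= [X in _ + X]C0 adde0.
Qed.

Lemma eq_measure_ae (mu : {measure set T -> \bar R}) (A B : set T) :
  measurable A -> measurable B -> {ae mu, forall w, A w <-> B w} ->
  mu A = mu B.
Proof.
move=> mA mB AB; apply/eqP; rewrite eq_le; apply/andP; split;
  apply: le_measure_ae => //; near=> w.
  by have [] : A w <-> B w by near: w.
by have [] : A w <-> B w by near: w.
Unshelve. all: by end_near. Qed.

Lemma measure_finite_bigcup (mu : {measure set T -> \bar R}) (J : finType)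
    (F : J -> set T) :
  (forall j, measurable (F j)) -> trivIset setT F ->
  mu (\bigcup_j F j) = (\sum_j mu (F j))%E.
Proof.
move=> mF tF; rewrite measure_fin_bigcup//; last exact: finite_finset.
rewrite fsbig_finite; last exact: finite_finset.
rewrite (perm_big (index_enum J))//=.
apply: uniq_perm; [exact: finmap.fset_uniq|exact: index_enum_uniq|].
by move=> j; rewrite in_fset_set ?mem_index_enum ?in_setT//; exact: finite_finset.
Qed.

End MeasureGeneralities.

Section ImageMeasure.
Context d1 d2 (T1 : measurableType d1) (T2 : measurableType d2) (R : realType).
Variables (mu : {measure set T1 -> \bar R}) (f : T1 -> T2).
Hypothesis mf : measurable_fun setT f.

Definition image_measure : {measure set T2 -> \bar R}.
Proof. by refine (pushforward mu f : {measure set T2 -> \bar R}); exact: mf. Defined.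

Lemma image_measureE A : image_measure A = mu (f @^-1` A).
Proof. by []. Qed.

End ImageMeasure.

Section Boxes.
Context (R : realType) (I : finType).
Implicit Types (b Q : I -> R * R) (z : I -> R).

(** Half-open sides let a box be cut into boxes with nothing left over. *)
Definition box b : set (I -> R) := [set z | forall i, (b i).1 < z i <= (b i).2].

(** Boxes generate the product sigma-algebra: [measurable_coord] and
    [measurable_vector] say so. *)
Definition coord_space := g_sigma_algebraType (range box).

Definition sub_box b Q :=
  forall i, [/\ (Q i).1 <= (b i).1, (b i).1 <= (b i).2 & (b i).2 <= (Q i).2].

Definition box_girth b : R := \sum_i ((b i).2 - (b i).1).

Definition box_meet b b' i :=
  (Num.max (b i).1 (b' i).1, Num.min (b i).2 (b' i).2).

Lemma box_meetE b b' : box b `&` box b' = box (box_meet b b').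
Proof.
apply/seteqP; split => [z [zb zb'] i|z zbb'].
  move: (zb i) (zb' i) => /andP[? ?] /andP[? ?].
  by rewrite /box_meet /= gt_max le_min; apply/andP; split; apply/andP.
by split=> i; have := zbb' i; rewrite /box_meet/= gt_max le_min;
  move=> /andP[/andP[? ?] /andP[? ?]]; apply/andP.
Qed.

Lemma sub_box_trans b Q Q' : sub_box b Q -> sub_box Q Q' -> sub_box b Q'.
Proof.
move=> bQ QQ' i; have [? ? ?] := bQ i; have [? ? ?] := QQ' i.
by split; lra.
Qed.

Definition subcell (N : nat) b (j : {ffun I -> 'I_N}) (i : I) : R * R :=
  let h := ((b i).2 - (b i).1) / N%:R in
  ((b i).1 + (j i)%:R * h, (b i).1 + (j i).+1%:R * h).

Section Subcells.
Variables (N : nat) (N0 : (0 < N)%N) (b : I -> R * R).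
Hypothesis bb : sub_box b b.
Let NR0 : 0 < N%:R :> R. Proof. by rewrite ltr0n. Qed.
Let h i := ((b i).2 - (b i).1) / N%:R.
Let h0 i : 0 <= h i.
Proof. by have [_ ? _] := bb i; rewrite /h divr_ge0 ?subr_ge0// ltW. Qed.
Let hN i : N%:R * h i = (b i).2 - (b i).1.
Proof. by rewrite /h mulrC divfK// gt_eqF. Qed.

Lemma sub_subcell j : sub_box (@subcell N b j) b.
Proof.
move=> i; rewrite /subcell/= -/(h i); split.
- by rewrite lerDl mulr_ge0.
- by rewrite lerD2l ler_wpM2r// ler_nat.
- rewrite -lerBrDl -hN ler_wpM2r// ler_nat; exact: ltn_ord.
Qed.

Lemma subcell_girth j : box_girth (@subcell N b j) = box_girth b / N%:R.
Proof.
rewrite /box_girth mulr_suml; apply: eq_bigr => i _.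
by rewrite /subcell/= -/(h i) -natr1; lra.
Qed.

Lemma subcell_cover : box b = \bigcup_j box (@subcell N b j).
Proof.
apply/seteqP; split => [z zb|z [j _ zj] i]; last first.
  have [? ? ?] := sub_subcell j i; have /andP[? ?] := zj i.
  by apply/andP; split; lra.
have ex i : exists k, z i <= (b i).1 + k%:R * h i.
  by exists N; have /andP[_] := zb i; rewrite hN addrC subrK.
pose k i := ex_minn (ex i).
have kP i : [/\ (0 < k i <= N)%N, z i <= (b i).1 + (k i)%:R * h i
    & (b i).1 + (k i).-1%:R * h i < z i].
  rewrite /k; case: ex_minnP => m zm mmin; have /andP[bz zb2] := zb i.
  have m0 : (0 < m)%N.
    by rewrite lt0n; apply/eqP => m0; move: zm; rewrite m0 mul0r addr0 leNgt bz.
  split => //.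
    by rewrite m0/=; apply: mmin; rewrite hN addrC subrK.
  rewrite ltNge; apply/negP => /mmin; lia.
have kN i : ((k i).-1 < N)%N by have [] := kP i; lia.
exists [ffun i => Ordinal (kN i)] => // i; rewrite /subcell ffunE/= -/(h i).
by have [/andP[k0 _] ? ?] := kP i; rewrite prednK//; apply/andP.
Qed.

Lemma subcell_trivIset (T : Type) (X : T -> I -> R) :
  trivIset setT (fun j => X @^-1` box (@subcell N b j)).
Proof.
move=> j j' _ _ [w [zj zj']]; apply/ffunP => i; apply: val_inj => /=.
have := zj i; have := zj' i; rewrite /subcell/= -/(h i).
move=> /andP[a1 a2] /andP[a3 a4].
have aux (m n : nat) : (b i).1 + m%:R * h i < X w i ->
  X w i <= (b i).1 + n.+1%:R * h i -> (m <= n)%N.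
  move=> H1 H2; have := lt_le_trans H1 H2; rewrite ltrD2l => H3.
  rewrite leqNgt; apply/negP => nm; have : n.+1%:R * h i <= m%:R * h i.
    by rewrite ler_wpM2r// ler_nat.
  by rewrite leNgt H3.
by apply/eqP; rewrite eqn_leq (aux _ _ a3 a2) (aux _ _ a1 a4).
Qed.

End Subcells.

Section Vectors.
Context d (T : measurableType d).

Lemma measurable_box (X : T -> I -> R) b :
  (forall i, measurable_fun setT (fun w => X w i)) ->
  measurable (X @^-1` box b).
Proof.
move=> mX; rewrite (_ : X @^-1` box b =
  \bigcap_(i in setT) ((fun w => X w i) @^-1` `](b i).1, (b i).2]%classic)).
  apply: fin_bigcap_measurable; first exact: finite_finset.
  by move=> i _; rewrite -[X in measurable X]setTI; exact: mX.
apply/seteqP; split => w /=; first by move=> H i _; rewrite /= in_itv/=; exact: H.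
by move=> H i; have := H i Logic.I; rewrite /= in_itv.
Qed.

Lemma measurable_vector (X : T -> coord_space) :
  (forall i, measurable_fun setT (fun w => X w i)) -> measurable_fun setT X.
Proof.
move=> mX; apply: (@measurability _ _ _ _ setT X (range box) erefl).
by move=> _ [_ [b _ <-] <-]; rewrite setTI; exact: measurable_box.
Qed.

End Vectors.

Lemma measurable_coord i : measurable_fun setT (fun z : coord_space => z i).
Proof.
apply: (@measurability _ _ _ _ _ _ (@RGenOInfty.G R)).
  exact: RGenOInfty.measurableE.
move=> _ [_ [a ->] <-]; rewrite setTI.
rewrite (_ : _ @^-1` _ = \bigcup_(n : nat) box (fun k =>
  if k == i then (a, n%:R) else (- n%:R, n%:R))).
  by apply: bigcupT_measurable => n; apply: sub_sigma_algebra; exists (fun k =>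
    if k == i then (a, n%:R) else (- n%:R, n%:R)).
apply/seteqP; split => [z|z [n _] /(_ i)]; rewrite /= in_itv/= andbT; last first.
  by rewrite eqxx/= => /andP[].
move=> az; pose n := (\sum_k Num.truncn `|z k|).+1.
have zn k : `|z k| < n%:R.
  apply: lt_le_trans (truncnS_gt _) _; rewrite ler_nat ltnS.
  by rewrite (bigD1 k)//= leq_addr.
exists n => // k /=; case: eqP => [->|_].
  by rewrite az/= (le_trans (ler_norm _))// ltW.
have := zn k; rewrite ltr_norml => /andP[-> ?]/=; exact: ltW.
Qed.

End Boxes.

(** * Equality in law from estimates on boxes *)

Lemma le_of_le_expR (R : realType) (p q K : R) : 0 <= q ->
  (forall N, (0 < N)%N -> p <= expR (K / N%:R) * q) -> p <= q.
Proof.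
move=> q0 H; rewrite leNgt; apply/negP => qp.
have K0 : 0 <= `|K| by [].
have q1 : 0 < q.
  rewrite lt_neqAle q0 andbT; apply/eqP => q00.
  by have := H 1%N isT; rewrite -q00 mulr0 leNgt q00 qp.
have pq : 1 < p / q by rewrite ltr_pdivlMr// mul1r.
have l0 : 0 < ln (p / q) by rewrite ln_gt0.
pose N := (Num.truncn (K / ln (p / q))).+1.
have N0 : 0 < N%:R :> R by rewrite ltr0n.
have /H : (0 < N)%N by [].
rewrite -ler_pdivrMr// -[p / q]lnK ?posrE ?(lt_trans _ pq)// ler_expR.
rewrite ler_pdivlMr// leNgt => /negP; apply.
rewrite mulrC -ltr_pdivrMr//; exact: truncnS_gt.
Qed.

Section Chains.
Context (R : realType) (I : finType) (e : rel I).
Implicit Types (b Q : I -> R * R) (z : I -> R).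

(** A pattern of strict inequalities between finitely many positive coordinates.
    It describes the staircase of the records as well as the zigzag of the
    levels. *)
Definition chain z := (forall i, 0 < z i) /\ (forall i j, e i j -> z i < z j).

(** All points of a separated box are chains, so that there a density supported by
    chains can be bounded above and below by its values at corners. *)
Definition separated b :=
  (forall i, 0 <= (b i).1 < (b i).2) /\
  (forall i j, e i j -> (b i).2 <= (b j).1).

Definition grid_cell (n : nat) (k : {ffun I -> nat}) (i : I) : R * R :=
  ((k i)%:R / n%:R, (k i).+1%:R / n%:R).

(** A chain has a smallest gap, and the cell of a grid finer than this gap is
    separated. Hence countably many separated boxes cover all chains. *)
Lemma chain_in_grid_cell z : chain z ->
  exists n k, separated (grid_cell n k) /\ box (grid_cell n k) z.
Proof.
move=> [z0 ze].
(* The sum exceeds the inverse of every gap. *)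
pose n := (\sum_(p : I * I) Num.truncn (z p.2 - z p.1)^-1).+1.
have n0 : 0 < n%:R :> R by rewrite ltr0n.
have gap i j : e i j -> z i + n%:R^-1 <= z j.
  move=> eij; have zij := ze _ _ eij.
  rewrite -lerBrDl -[leRHS]invrK lef_pV2 ?posrE ?invr_gt0 ?subr_gt0//.
  apply/ltW; apply: lt_le_trans (truncnS_gt _) _.
  by rewrite ler_nat ltnS (bigD1 (i, j))//= leq_addr.
have ex i : exists k, z i <= k.+1%:R / n%:R.
  exists (Num.truncn (z i * n%:R)); rewrite ler_pdivlMr//.
  exact/ltW/truncnS_gt.
pose k := [ffun i => ex_minn (ex i)].
have kP i : (k i)%:R / n%:R < z i <= (k i).+1%:R / n%:R.
  rewrite ffunE; case: ex_minnP => m zm mmin; rewrite zm andbT.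
  case: m zm mmin => [|m] zm mmin; first by rewrite mul0r.
  by rewrite ltNge; apply/negP => /mmin; rewrite ltnn.
exists n, k; split => //; split => [i|i j eij] /=.
  by rewrite divr_ge0//= ltr_pM2r ?invr_gt0// ltr_nat.
rewrite ler_pM2r ?invr_gt0// ler_nat -ltnS -(ltr_nat R).
have := gap _ _ eij; have /andP[zi _] := kP i; have /andP[_ zj] := kP j.
move=> gij; rewrite -(ltr_pM2r (_ : 0 < n%:R^-1)) ?invr_gt0//.
apply: lt_le_trans zj; apply: lt_le_trans gij.
by rewrite -addn1 natrD mulrDl mul1r ltrD2r.
Qed.

End Chains.

Section LawFromBoxes.
Context (R : realType) (I : finType).

Section OneBox.
Context d (T : measurableType d) (P : probability T R) (X : T -> I -> R).
Context d' (T' : measurableType d') (P' : probability T' R) (X' : T' -> I -> R).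

(** Comparison up to a factor that tends to 1 when the box shrinks, as given by
    two-sided estimates with one density whose logarithm is Lipschitz on Q. *)
Definition box_dominated (Q : I -> R * R) := exists C : R,
  forall b, sub_box b Q ->
  (P (X @^-1` box b) <= (expR (C * box_girth b))%:E * P' (X' @^-1` box b))%E.

Hypothesis mX : forall i, measurable_fun setT (fun w => X w i).
Hypothesis mX' : forall i, measurable_fun setT (fun w => X' w i).

(** Cutting the box into equal cells, N along each side, turns the factor
    exp (C g) into exp (C g / N), for every N. *)
Lemma le_box_dominated Q b : box_dominated Q -> sub_box b Q ->
  (P (X @^-1` box b) <= P' (X' @^-1` box b))%E.
Proof.
move=> [C dom] bQ.
have bb : sub_box b b by move=> i; have [_ ? _] := bQ i.
have mb := @measurable_box _ _ _ _ X _ mX.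
have mb' := @measurable_box _ _ _ _ X' _ mX'.
rewrite -(@fineK _ (P _)) ?fin_num_measure// -(@fineK _ (P' _)) ?fin_num_measure//.
rewrite lee_fin; apply: (@le_of_le_expR _ _ _ (C * box_girth b)) => [|N N0].
  exact: fine_ge0.
rewrite -lee_fin EFinM !fineK ?fin_num_measure//.
rewrite {1}(subcell_cover N0 bb) preimage_bigcup measure_finite_bigcup//; last first.
  exact: subcell_trivIset.
rewrite [X in (_ <= _ * P' (_ @^-1` X))%E](subcell_cover N0 bb).
rewrite preimage_bigcup measure_finite_bigcup//; last exact: subcell_trivIset.
rewrite ge0_sume_distrr//; apply: lee_sum => j _.
have sj := sub_box_trans (sub_subcell N0 bb j) bQ.
by apply: le_trans (dom _ sj) _; rewrite subcell_girth mulrA.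
Qed.

End OneBox.

Section Law.
Context d (T : measurableType d) (P : probability T R) (X : T -> I -> R).
Context d' (T' : measurableType d') (P' : probability T' R) (X' : T' -> I -> R).
Hypothesis mX : forall i, measurable_fun setT (fun w => X w i).
Hypothesis mX' : forall i, measurable_fun setT (fun w => X' w i).

(** Boxes are stable under intersection, so that agreement on the subboxes of Q
    spreads to all measurable subsets of Q. *)
Lemma eq_law_in_box Q (S : set (coord_space R I)) :
  box_dominated P X P' X' Q -> box_dominated P' X' P X Q -> measurable S ->
  P (X @^-1` (S `&` box Q)) = P' (X' @^-1` (S `&` box Q)).
Proof.
move=> dom dom' mS.
have mXT : measurable_fun setT (X : T -> coord_space R I) by exact: measurable_vector.
have mXT' : measurable_fun setT (X' : T' -> coord_space R I) by exact: measurable_vector.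
have mQ : measurable (box Q : set (coord_space R I)).
  by apply: sub_sigma_algebra; exists Q.
pose m1 := mrestr (image_measure P mXT) mQ.
pose m2 := mrestr (image_measure P' mXT') mQ.
have boxE b : P (X @^-1` (box b `&` box Q)) = P' (X' @^-1` (box b `&` box Q)).
  rewrite box_meetE.
  have [[i lei]|] := pselect (exists i, (box_meet b Q i).2 < (box_meet b Q i).1).
    have -> : box (box_meet b Q) = set0.
      by apply/seteqP; split => // z /(_ i) /andP[z1 z2]; lra.
    by rewrite !preimage_set0 !measure0.
  move=> /forallNP nlt.
  have sb : sub_box (box_meet b Q) Q.
    move=> i; have := nlt i => /negP; rewrite -leNgt => ?.
    by split=> //; rewrite /box_meet/= ?le_max ?ge_min lexx orbT.
  by apply/eqP; rewrite eq_le !(le_box_dominated _ _ _ sb).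
rewrite -[LHS]/(m1 S) -[RHS]/(m2 S).
have Gm : range (@box R I) `<=` @measurable _ (coord_space R I).
  by move=> _ [b _ <-]; apply: sub_sigma_algebra; exists b.
pose g n : set (coord_space R I) := box (fun=> (- n%:R, n%:R)).
apply: (@g_sigma_algebra_measure_unique _ R (coord_space R I) (range (@box R I))
  Gm g _ _ m1 m2) => //.
- apply/seteqP; split => // z _.
  pose n := (\sum_k Num.truncn `|z k|).+1.
  have zn k : `|z k| < n%:R.
    apply: lt_le_trans (truncnS_gt _) _; rewrite ler_nat ltnS.
    by rewrite (bigD1 k)//= leq_addr.
  exists n => // k /=; have := zn k.
  by rewrite ltr_norml => /andP[-> ?]/=; exact: ltW.
- by move=> _ _ [b _ <-] [b' _ <-]; rewrite box_meetE; exists (box_meet b b').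
- by move=> _ [b _ <-]; exact: boxE.
- move=> k; apply: (@le_lt_trans _ _ 1%E); last exact: ltry.
  apply: probability_le1; rewrite -[X in measurable X]setTI.
  apply: (mXT) => //; apply: measurableI => //; apply: Gm.
  by exists (fun=> (- k%:R, k%:R)).
Qed.

Variable e : rel I.
Hypothesis chainX : {ae P, forall w, chain e (X w)}.
Hypothesis chainX' : {ae P', forall w, chain e (X' w)}.
Hypothesis dom : forall Q, separated e Q -> box_dominated P X P' X' Q.
Hypothesis dom' : forall Q, separated e Q -> box_dominated P' X' P X Q.

(** Two laws carried by chains are identified by comparing them on small
    separated boxes, without integrating any density. *)
Theorem eq_law_of_box_dominated (S : set (coord_space R I)) :
  measurable S -> P (X @^-1` S) = P' (X' @^-1` S).
Proof.
pose B m : set (coord_space R I) := if @unpickle (nat * {ffun I -> nat})%type m is Some nk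
  then if `[< separated e (@grid_cell R I nk.1 nk.2) >]
       then box (grid_cell R nk.1 nk.2) else set0
  else set0.
have mB m : measurable (B m).
  rewrite /B; case: unpickle => [nk|//]; case: asboolP => // _.
  by apply: sub_sigma_algebra; exists (grid_cell R nk.1 nk.2).
have PB m S' : measurable S' -> P (X @^-1` (S' `&` B m)) = P' (X' @^-1` (S' `&` B m)).
  move=> mS'; rewrite /B; case: unpickle => [nk|]; last by rewrite setI0 !preimage_set0 !measure0.
  case: asboolP => [sep|_]; last by rewrite setI0 !preimage_set0 !measure0.
  exact: (eq_law_in_box (dom sep) (dom' sep) mS').
have cov z : chain e z -> (\bigcup_m B m) z.
  move=> /chain_in_grid_cell[n [k [sep bz]]].
  by exists (pickle (n, k)) => //; rewrite /B pickleK; case: asboolP.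
move=> mS.
(* The sets B m made disjoint, so that the equalities on each of them add up. *)
have mD m : measurable (seqDU B m) by apply: seqDU_measurable.
have mSD m : measurable (S `&` seqDU B m) by exact: measurableI.
have redu d0 (T0 : measurableType d0) (P0 : probability T0 R) (X0 : T0 -> I -> R) :
    (forall i, measurable_fun setT (fun w => X0 w i)) ->
    {ae P0, forall w, chain e (X0 w)} ->
    P0 (X0 @^-1` S) = (\sum_(m <oo) P0 (X0 @^-1` ((S `&` seqDU B m) `&` B m)))%E.
  move=> mX0 ch0.
  have mXT : measurable_fun setT (X0 : T0 -> coord_space R I) by exact: measurable_vector.
  have mpre (S0 : set (coord_space R I)) : measurable S0 -> measurable (X0 @^-1` S0).
    by move=> mS0; rewrite -[X in measurable X]setTI; exact: mXT.
  have DB m : (S `&` seqDU B m) `&` B m = S `&` seqDU B m.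
    apply/seteqP; split => [z [] //|z [Sz Dz]]; split => //.
    exact: (@subset_seqDU _ B).
  transitivity (P0 (\bigcup_m (X0 @^-1` (S `&` seqDU B m)))).
    apply: eq_measure_ae => //; first exact: mpre.
      by apply: bigcupT_measurable => m; exact: mpre.
    apply: filterS ch0 => w /cov; rewrite (seqDU_bigcup_eq B) => -[m _ Dm].
    by split => [Sw|[? _ []]//]; exists m.
  rewrite measure_semi_bigcup.
  - by under [RHS]eq_eseriesr do rewrite DB.
  - by move=> m; exact: mpre.
  - move=> m m' _ _ [w [[_ Dm] [_ Dm']]].
    by apply: (@trivIset_seqDU _ B m m') => //; exists (X0 w).
  - by apply: bigcupT_measurable => m; exact: mpre.
rewrite (redu _ _ P X)// (redu _ _ P' X')//.
by apply: eq_eseriesr => m _; exact: PB.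
Qed.

End Law.
End LawFromBoxes.

(** * Products, conditioning and the driving law *)

Section ProductBounds.
Context d1 d2 (T1 : measurableType d1) (T2 : measurableType d2) (R : realType).
Local Open Scope ereal_scope.

(** Bounds on the sections over A integrate to bounds on the whole set. *)
Lemma product_measure_bounds (m1 : {measure set T1 -> \bar R})
    (m2 : {sigma_finite_measure set T2 -> \bar R}) (A : set T1)
    (D : set (T1 * T2)) (lo hi : R) :
  measurable A -> measurable D -> (0 <= lo)%R ->
  (forall x, A x -> lo%:E <= m2 (xsection D x) <= hi%:E) ->
  (forall x, ~ A x -> xsection D x = set0) ->
  lo%:E * m1 A <= (m1 \x m2) D <= hi%:E * m1 A.
Proof.
move=> mA mD lo0 DA DnA.
have [[x0 Ax0]|A0] := pselect (A !=set0); last first.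
  have -> : A = set0 by apply/eqP; apply/negP => /negP /set0P.
  rewrite measure0 !mule0 /product_measure1 integral0_eq ?lexx//= => x _.
  rewrite DnA ?measure0// => Ax.
  by apply: A0; exists x.
have hi0 : (0 <= hi)%R.
  by have /andP[l h] := DA _ Ax0; have := le_trans l h; rewrite lee_fin; exact: le_trans.
have cstE (c : R) : (0 <= c)%R -> c%:E * m1 A = \int[m1]_x (c * \1_A x)%:E.
  move=> c0; under eq_integral do rewrite EFinM.
  rewrite ge0_integralZl//; last exact/measurable_EFinP/measurable_indic.
  by rewrite integral_indic// setIT.
rewrite !cstE// /product_measure1.
have mid : measurable_fun setT (m2 \o xsection D) by exact: measurable_fun_xsection.
have mc (c : R) : measurable_fun setT (fun x => (c * \1_A x)%:E).
  by apply/measurable_EFinP; apply: measurable_funM => //; exact: measurable_indic.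
apply/andP; split; apply: ge0_le_integral => //=.
- by move=> x _; rewrite lee_fin mulr_ge0.
- move=> x _; rewrite indicE; case: (boolP (x \in A)) => [/set_mem Ax|].
    by rewrite mulr1; have /andP[] := DA _ Ax.
  by rewrite mulr0.
- move=> x _; rewrite indicE; case: (boolP (x \in A)) => [/set_mem Ax|/negP].
    by rewrite mulr1; have /andP[] := DA _ Ax.
  by move=> nAx; rewrite DnA ?measure0 ?mulr0// => Ax; apply: nAx; exact/mem_set.
Qed.

End ProductBounds.

Section ProductProbability.
Context d1 d2 (T1 : measurableType d1) (T2 : measurableType d2) (R : realType).
Variables (P1 : probability T1 R) (P2 : probability T2 R).

Let product_setT : ((P1 \x P2) setT = 1)%E.
Proof. rewrite -setXTT [LHS]product_measure1E//.
rewrite [X in (X * _)%E](_ : _ = 1%E) ?mul1e; exact: probability_setT. Qed.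

Definition product_probability : probability (T1 * T2)%type R :=
  HB.pack (P1 \x P2)%E (Measure_isProbability.Build _ _ _ (P1 \x P2)%E product_setT).

Lemma product_probabilityX A B : measurable A -> measurable B ->
  product_probability (A `*` B) = (P1 A * P2 B)%E.
Proof. exact: product_measure1E. Qed.

Lemma product_probability_bounds A D (lo hi : R) :
  measurable A -> measurable D -> 0 <= lo ->
  (forall x, A x -> lo%:E <= P2 (xsection D x) <= hi%:E)%E ->
  (forall x, ~ A x -> xsection D x = set0) ->
  (lo%:E * P1 A <= product_probability D <= hi%:E * P1 A)%E.
Proof. exact: product_measure_bounds. Qed.

End ProductProbability.

Section Freezing.
Context d1 d2 d3 (T : measurableType d1) (T1 : measurableType d2)
  (T2 : measurableType d3) (R : realType).
Variables (P : probability T R) (Q : probability T2 R).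

(** The variable xi has law Q and is independent of A and W, so it can be
    integrated out with W frozen. It is enough to know this on rectangles, which
    determine the joint law of W and xi on A. *)
Lemma freezing (A : set T) (W : T -> T1) (xi : T -> T2) (D : set (T1 * T2))
    (B : set T1) (lo hi : R) :
  measurable A -> measurable_fun setT W -> measurable_fun setT xi ->
  (forall C G, measurable C -> measurable G ->
     P (A `&` W @^-1` C `&` xi @^-1` G) = P (A `&` W @^-1` C) * Q G)%E ->
  measurable D -> measurable B -> A `<=` W @^-1` B ->
  0 <= lo -> (forall x, B x -> (lo%:E <= Q (xsection D x) <= hi%:E)%E) ->
  (lo%:E * P A <= P (A `&` [set w | D (W w, xi w)]) <= hi%:E * P A)%E.
Proof.
move=> mA mW mxi ind mD mB AB lo0 loBhi.
have mWxi : measurable_fun setT (fun w => (W w, xi w)) by exact: measurable_fun_pair.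
have trace d0 (T0 : measurableType d0) (f : T -> T0) : measurable_fun setT f ->
    exists m : {measure set T0 -> \bar R}, forall C, m C = P (A `&` f @^-1` C).
  move=> mf; exists (image_measure (mrestr P mA) mf) => C.
  by rewrite image_measureE /= /mrestr setIC.
have [al alE] := trace _ _ _ mW; have [be beE] := trace _ _ _ mWxi.
have alT : (al setT < +oo)%E.
  by rewrite alE preimage_setT setIT ltey_eq fin_num_measure.
pose al' : {finite_measure set T1 -> \bar R} := mfrestr measurableT alT.
have al'E C : al' C = P (A `&` W @^-1` C).
  by rewrite /al'/= /mfrestr /mrestr setIT alE.
have prodE X : measurable X -> ((al' \x Q) X = be X)%E.
  apply: product_measure_unique => C G mC mG.
  rewrite beE [X in (X * _)%E](al'E C) -ind//; congr (P _); apply/seteqP; split => w /=; tauto.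
pose D' := D `&` (B `*` setT).
have mD' : measurable D' by apply: measurableI => //; exact: measurableX.
have -> : A `&` [set w | D (W w, xi w)] = A `&` (fun w => (W w, xi w)) @^-1` D'.
  apply/seteqP; split => w /=; last by case=> ? [? _].
  by move=> [Aw Dw]; split => //; split => //; split => //; exact: AB.
have -> : P A = al' B.
  rewrite al'E; congr (P _).
  by apply/seteqP; split => w /=; [move=> Aw; split => //; exact: AB|case].
rewrite -beE -prodE//.
apply: product_measure_bounds => // [x Bx|x nBx].
  rewrite (_ : xsection D' x = xsection D x); first exact: loBhi.
  by apply/seteqP; split => y; rewrite /xsection /D'/= !inE/=; tauto.
by apply/seteqP; split => y //; rewrite /xsection /D'/= !inE/=; tauto.
Qed.

End Freezing.

Section Driver.
Context (R : realType).

(* Lebesgue measure, and the laws built on it, live on a copy of R with another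
   display; [retype] carries laws over to R. *)
Let retype : measurableTypeR R -> R := idfun.

#[local] HB.instance Definition _ :=
  @isMeasurableFun.Build _ _ _ _ retype (@measurable_id _ _ setT).

Let exponential1 : probability (measurableTypeR R) R.
Proof.
refine (exponential_distribution_exponential_prob__canonical__probability_measure_Probability _).
exact: ltr01.
Defined.

Definition unit_exponential : probability R R :=
  distribution exponential1 retype.

Definition unit_uniform : probability R R :=
  distribution (uniform_prob (@ltr01 R)) retype.

(** The law of the pair (E, U) that leads from one record to the next one. *)
Definition driver : probability (R * R)%type R :=
  product_probability unit_exponential unit_uniform.

Lemma unit_exponential_bounds (a b : R) : 0 <= a <= b ->
  (((b - a) * expR (- b))%:E <= unit_exponential `]a, b]%classic
     <= ((b - a) * expR (- a))%:E)%E.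
Proof.
move=> /andP[a0 ab].
have cstE (c : R) : ((b - a) * c)%:E =
    (\int[lebesgue_measure]_(x in `]a, b]%classic) (cst c%:E) x)%E.
  rewrite integral_cst// [X in (_ * X)%E](_ : _ = (b - a)%:E).
    by rewrite -EFinM mulrC.
  rewrite [LHS]lebesgue_measure_itv/= lte_fin; case: ltP => // ba.
  by rewrite (@le_anti _ _ a b) ?subrr// ab ba.
have mpdf : measurable_fun `]a, b]%classic (fun x => (exponential_pdf 1 x)%:E : \bar R).
  apply/measurable_EFinP; apply: measurable_funTS.
  exact: measurable_exponential_pdf.
have pdfE x : a < x -> x <= b -> exponential_pdf 1 x = expR (- x) :> R.
  by move=> ax xb; rewrite exponential_pdfE ?mul1r ?mulN1r// (le_trans a0)// ltW.
rewrite !cstE -[unit_exponential _]/(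
  \int[lebesgue_measure]_(x in `]a, b]%classic) (exponential_pdf 1 x)%:E)%E.
apply/andP; split; apply: ge0_le_integral => //=.
- by move=> x; rewrite in_itv/= => /andP[ax xb]; rewrite pdfE// lee_fin ler_expR lerN2.
- by move=> x; rewrite in_itv/= => /andP[ax xb]; rewrite pdfE// lee_fin expR_ge0.
- move=> x; rewrite in_itv/= => /andP[ax xb].
  by rewrite pdfE// lee_fin ler_expR lerN2 ltW.
Qed.

Lemma unit_uniformE (a b : R) : 0 <= a -> a <= b -> b <= 1 ->
  unit_uniform `]a, b]%classic = (b - a)%:E.
Proof.
move=> a0 ab b1; rewrite -[LHS]/(
  \int[lebesgue_measure]_(x in `]a, b]%classic) (uniform_pdf 0 1 x)%:E)%E.
rewrite (eq_integral (cst 1%E)); last first.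
  move=> x; rewrite inE/= in_itv/= => /andP[ax xb].
  by rewrite /uniform_pdf (le_trans a0 (ltW ax)) (le_trans xb b1)/= subr0 invr1.
rewrite integral_cst// mul1e [LHS]lebesgue_measure_itv/= lte_fin; case: ltP => // ba.
by rewrite (@le_anti _ _ a b) ?subrr// ab ba.
Qed.

End Driver.

(** * Areas and counts *)

Section Area.
Context (R : realType).
Implicit Types (B : set (R * R)) (a b c d : R).

Lemma area_rectangle (xa xb xc xd : bool) a b c d : a <= b -> c <= d ->
  area ([set` Interval (BSide xa a) (BSide xb b)] `*`
        [set` Interval (BSide xc c) (BSide xd d)]) = ((b - a) * (d - c))%:E.
Proof.
move=> ab cd.
have len (x y : bool) (p q : R) : p <= q ->
    lebesgue_measure [set` Interval (BSide x p) (BSide y q)] = (q - p)%:E.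
  move=> pq; rewrite [LHS]lebesgue_measure_itv/= lte_fin; case: ltP => // qp.
  by rewrite (@le_anti _ _ p q) ?subrr// pq qp.
rewrite /area product_measure1E//.
by rewrite [X in (X * _)%E]len// [X in (_ * X)%E]len.
Qed.

Lemma area_finite_bigcup (J : finType) (F : J -> set (R * R)) :
  (forall j, measurable (F j)) -> trivIset setT F ->
  area (\bigcup_j F j) = (\sum_j area (F j))%E.
Proof. by move=> mF tF; rewrite /area measure_finite_bigcup. Qed.

Lemma le_area B B' : measurable B -> measurable B' -> B `<=` B' ->
  (area B <= area B')%E.
Proof.
move=> mB mB' BB'.
by apply: (@le_measure _ _ _ (@lebesgue_measure R \x @lebesgue_measure R)%E);
  rewrite ?inE.
Qed.

Lemma area_bigsetU_le m (F : nat -> set (R * R)) :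
  (forall i, measurable (F i)) ->
  (area (\big[setU/set0]_(i < m) F i) <= \sum_(i < m) area (F i))%E.
Proof.
move=> mF.
by apply: (Boole_inequality (@lebesgue_measure R \x @lebesgue_measure R)%E) => i _;
  exact: mF.
Qed.

Lemma area_ge0 B : (0 <= area B)%E.
Proof. by rewrite /area; exact: measure_ge0. Qed.

Lemma area_diagonal : area [set a : R * R | a.1 = a.2] = 0%E.
Proof.
rewrite /area /product_measure1 integral0_eq// => x _ /=.
rewrite (_ : xsection _ x = [set x]) ?[LHS]lebesgue_measure_set1//.
by apply/seteqP; split => y; rewrite /xsection/= inE/=.
Qed.

Lemma measurable_diagonal : measurable [set a : R * R | a.1 = a.2].
Proof.
rewrite (_ : [set _ | _] = (fun a : R * R => a.1 - a.2) @^-1` [set 0]).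
  rewrite -[X in measurable X]setTI; apply: measurable_funB => //.
apply/seteqP; split => -[x y]/=; first by move=> ->; rewrite subrr.
by move=> /eqP; rewrite subr_eq0 => /eqP.
Qed.

End Area.

Section Counting.
Context (T : choiceType) (R : realType).
Implicit Types A : set T.

Lemma counting_eq0 A : counting A = 0%:R%:E :> \bar R <-> A = set0.
Proof.
rewrite /counting; case: asboolP => [fA|nfA]; last first.
  by split => // A0; exfalso; apply: nfA; rewrite A0.
split=> [[]/eqP|->]; last by rewrite fset_set0 finmap.cardfs0.
by rewrite pnatr_eq0 finmap.cardfs_eq0 => /eqP /fset_set_set0->.
Qed.

Lemma counting_eq1 A : counting A = 1%:R%:E :> \bar R ->
  exists2 q, A q & forall a, A a -> a = q.
Proof.
rewrite /counting; case: asboolP => [fA|//] [/eqP].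
rewrite eqr_nat => /finmap.cardfs1P[q Aq]; exists q.
  by rewrite -(fset_setK fA) Aq set_fset1.
by move=> a; rewrite -(fset_setK fA) Aq set_fset1.
Qed.

Lemma counting_finite A k : counting A = k%:R%:E :> \bar R -> finite_set A.
Proof. by rewrite /counting; case: asboolP. Qed.

End Counting.

(** * Records and staircases of cells *)

(** [order] breaks conjunctions of bounds in the context before calling [lra]. *)
Ltac split_all :=
  intros; repeat match goal with
  | H : _ /\ _ |- _ => destruct H
  | H : and3 _ _ _ |- _ => destruct H
  | H : and4 _ _ _ _ |- _ => destruct H
  | H : is_true (_ && _) |- _ => move: H => /andP H
  end; repeat split; try (apply/andP; split).
Ltac order := split_all; lra.

Section Staircase.
Context (R : realType).

(** The first step of a staircase starts on the axis, the other ones at the side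
    of a cell. *)
Definition from_axis (u : nat -> R) (k : nat) : R := if k is 0 then 0 else u k.

Section Boxes.
Variables (m : nat) (s s' y y' : nat -> R).

Definition cell k : set (R * R) := `]s k, s' k] `*` `]y k, y' k].

(** Wherever one point is placed in each cell, the region below the staircase
    through these points is covered by the outer steps and contains the inner
    steps. *)
Definition outer_step k : set (R * R) :=
  `[from_axis s k, s' k.+1] `*` `[0, y' k].

Definition inner_step k : set (R * R) :=
  `]from_axis s' k, s k.+1] `*` `]0, y k].

(** The last two conditions put cell 0 above the line t = x and cell 1 below it,
    which pins down the labels of records found in the cells. *)
Definition descending : Prop :=
  [/\ forall k, (k <= m)%N -> [/\ 0 <= s k, s k <= s' k, 0 <= y k & y k <= y' k],
      forall k, (k < m)%N -> s' k <= s k.+1 /\ y' k.+1 <= y k,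
      s' 0%N <= y 0%N & y' 1%N <= s 1%N].

Lemma descending_le : descending -> forall i j, (i <= j <= m)%N ->
  s' i <= s' j /\ y' j <= y' i.
Proof.
move=> [D1 D2 _ _] i; elim=> [|j IH]; first by rewrite leqn0 => /andP[/eqP->].
case: (leqP i j) => ij; last by move=> ?; have -> : i = j.+1 by lia.
move=> /andP[_ jm]; have := IH ltac:(lia).
by have := D1 j.+1 jm; have := D1 j (ltnW jm); have := D2 j jm; order.
Qed.

Lemma descending_lt : descending -> forall i j, (i < j <= m)%N ->
  s' i <= s j /\ y' j <= y i.
Proof.
move=> desc i [//|j] /andP[ij jm]; have := descending_le desc (_ : i <= j <= m)%N.
have := descending_le desc (_ : i.+1 <= j.+1 <= m)%N; have [_ D2 _ _] := desc.
by have := D2 j jm; have := D2 i ltac:(lia); move=> ? ? /(_ ltac:(lia)) ? /(_ ltac:(lia)); order.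
Qed.

End Boxes.

Section Config.
Variables (A : set (R * R)) (r : int -> R * R).
Hypothesis Aquad : A `<=` quadrant.
Hypothesis lab : records_labelling A r.

Lemma south_east_lt (a b : int) : (a < b)%R -> south_east (r a) (r b).
Proof.
have [_ step _] := lab; move=> ab.
have -> : b = a + (`|b - a|%N.-1).+1%:Z by lia.
elim: (`|b - a|%N.-1) => [|n IH]; first exact: step.
have -> : a + n.+2%:Z = (a + n.+1%:Z) + 1 by lia.
have := step (a + n.+1%:Z); move: IH; rewrite /south_east.
move=> /andP[? ?] /andP[? ?]; apply/andP; split; lra.
Qed.

Lemma south_east_le (a b : int) : (a <= b)%R -> (r a).1 <= (r b).1 /\ (r b).2 <= (r a).2.
Proof.
rewrite le_eqVlt => /predU1P[->//|/south_east_lt /andP[? ?]]; split; exact: ltW.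
Qed.

Lemma record_in k : A (r k).
Proof.
have [rR _ _] := lab; have : records A (r k) by rewrite -rR; exists k.
by case.
Qed.

Lemma record_pos k : 0 < (r k).1 /\ 0 < (r k).2.
Proof.
have /andP[? _] : south_east (r (k - 1)) (r k) by apply: south_east_lt; lia.
have /andP[_ ?] : south_east (r k) (r (k + 1)) by apply: south_east_lt; lia.
have [? _] := Aquad (record_in (k - 1)); have [_ ?] := Aquad (record_in (k + 1)).
split; lra.
Qed.

(** Among the finitely many atoms weakly south-west of a, one with the least sum
    of coordinates is a record. *)
Lemma record_below a : A a ->
  finite_set (A `&` (`[0, a.1] `*` `[0, a.2])) ->
  exists k, (r k).1 <= a.1 /\ (r k).2 <= a.2.
Proof.
move=> Aa /finite_seqP[l lE].
have Aquad' p : A p -> p.1 <= a.1 -> p.2 <= a.2 -> p \in l.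
  move=> Ap p1 p2; have [? ?] := Aquad Ap.
  suff : [set` l] p by [].
  by rewrite -lE; split => //; split => /=; rewrite in_itv/=; apply/andP.
have lA p : p \in l -> [/\ A p, p.1 <= a.1 & p.2 <= a.2].
  move=> pl; have : [set` l] p by [].
  by rewrite -lE => -[Ap []]; rewrite /= !in_itv/= => /andP[_ ?] /andP[_ ?].
have al : a \in l by exact: Aquad'.
have [p pl pmin] : exists2 p, p \in l & forall q, q \in l -> p.1 + p.2 <= q.1 + q.2.
  move: al; clear; elim: l a => // c l IH a _.
  case: l IH => [|c' l] IH; first by exists c; rewrite ?inE// => q; rewrite inE => /eqP->.
  have [p pl pmin] := IH c' (mem_head _ _).
  case: (leP (p.1 + p.2) (c.1 + c.2)) => pc.
    by exists p => [|q]; rewrite inE ?pl ?orbT// => /predU1P[->//|/pmin].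
  exists c => [|q]; rewrite inE ?eqxx// => /predU1P[->//|/pmin]; lra.
have [Ap p1 p2] := lA _ pl.
have : records A p.
  split => // -[c Ac /andP[c1 c2]].
  have : c \in l by apply: Aquad' => //; lra.
  by move=> /pmin; lra.
have [<- _ _] := lab; move=> [k _ rk]; exists k; rewrite rk; split => //; lra.
Qed.

Section InBoxes.
Variables (m : nat) (s s' y y' : nat -> R).
Hypothesis desc : descending m s s' y y'.

(** An atom in inner step k lies weakly north-east of some record r j. Its time
    forces j <= k and its value forces j > k. *)
Lemma inner_step_empty k : (k < m)%N ->
  (forall i, (i <= m)%N -> cell s s' y y' i (r i)) ->
  (forall a, A a -> finite_set (A `&` (`[0, a.1] `*` `[0, a.2]))) ->
  A `&` inner_step s s' y k = set0.
Proof.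
move=> km rQ fin; apply/seteqP; split => // a [Aa []]; rewrite /= !in_itv/=.
move=> /andP[_ a1] /andP[_ a2].
have [j [j1 j2]] := record_below Aa (fin _ Aa).
have [] := rQ _ km; rewrite /= !in_itv/= => /andP[t1 _] _.
have [] := rQ _ (ltnW km); rewrite /= !in_itv/= => _ /andP[x1 _].
case: (leP j k%:Z) => jk.
  have [_] := south_east_le jk; lra.
have [] : (r k.+1).1 <= (r j).1 /\ (r j).2 <= (r k.+1).2.
  by apply: south_east_le; lia.
lra.
Qed.

(** Any atom strictly south-west of the atom q i of cell i, and any record between
    q i and q i.+1, would lie in an outer step, hence be some q j, which the
    positions of the cells exclude. So the q i are consecutive records, and the
    line t = x between q 0 and q 1 shows that they are r 0, ..., r m. *)
Lemma cell_records : (0 < m)%N ->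
  (forall i, (i <= m)%N -> exists2 q, (A `&` cell s s' y y' i) q &
     forall a, (A `&` cell s s' y y' i) a -> a = q) ->
  (forall a k, (k < m)%N -> A a -> outer_step s s' y' k a ->
     exists2 i, (i <= m)%N & cell s s' y y' i a) ->
  forall i, (i <= m)%N -> cell s s' y y' i (r i).
Proof.
move=> m0 Hq Hout.
have [D1 D2 D3 D4] := desc.
have /choice[q qQ] : forall i, exists q, (i <= m)%N ->
    (A `&` cell s s' y y' i) q /\ forall a, (A `&` cell s s' y y' i) a -> a = q.
  move=> i; case: (leqP i m) => im; last by exists (0, 0).
  by have [p Ap pU] := Hq i im; exists p.
have qP i : (i <= m)%N -> [/\ A (q i), s i < (q i).1 <= s' i & y i < (q i).2 <= y' i].
  by move=> /qQ[[Aq []]]; rewrite /= !in_itv.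
have qU i a : (i <= m)%N -> A a -> cell s s' y y' i a -> a = q i.
  by move=> /qQ[_ qU] Aa aQ; exact: qU.
have sm := descending_le desc; have ssm := descending_lt desc.
have qlt i j : (i < j <= m)%N -> (q i).1 < (q j).1 /\ (q j).2 < (q i).2.
  move=> ijm; have [_ ? ?] := qP i ltac:(lia); have [_ ? ?] := qP j ltac:(lia).
  have := ssm _ _ ijm; order.
have qlt1 i j : (i <= m)%N -> (j <= m)%N -> (q i).1 < (q j).1 -> (i < j)%N.
  move=> im jm qij; rewrite ltnNge; apply/negP; rewrite leq_eqVlt => /predU1P[ji|ji].
    by move: qij; rewrite ji ltxx.
  by have := qlt j i ltac:(lia); order.
have incell a i : A a -> (i < m)%N -> from_axis s i <= a.1 -> a.1 <= s' i.+1 ->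
    a.2 <= y' i -> exists2 j, (j <= m)%N & a = q j.
  move=> Aa im a1 a1' a2; have [? ?] := Aquad Aa.
  have [|j jm aj] := Hout a i im Aa.
    by split; rewrite /= in_itv/=; apply/andP.
  by exists j => //; exact: qU.
have cover a i : A a -> (0 < i <= m)%N -> a.1 <= s' i ->
    exists2 k, (k < i)%N & from_axis s k <= a.1 <= s' k.+1.
  move=> Aa; have [a10 _] := Aquad Aa; elim: i => // i IH im ai.
  case: i IH im ai => [|i] IH im ai; first by exists 0%N => //=; rewrite a10.
  case: (leP a.1 (s' i.+1)) => ai'.
    by have [k ki kP] := IH ltac:(lia) ai'; exists k => //; lia.
  by exists i.+1 => //=; have := D1 i.+1 ltac:(lia); rewrite ai; order.
have qrec i : (i <= m)%N -> records A (q i).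
  move=> im; have [Aq q1 q2] := qP i im; split => // -[a Aa /andP[a1 a2]].
  have [j jm aj] : exists2 j, (j <= m)%N & a = q j.
    (* Step 0 reaches beyond cell 0, hence the maximum. *)
    have [k ki /andP[ka ka']] : exists2 k, (k < maxn i 1)%N & from_axis s k <= a.1 <= s' k.+1.
      apply: cover => //; first lia.
      by have := sm i (maxn i 1) ltac:(lia); order.
    apply: (incell a k) => //; first by clear -im ki m0; lia.
    by have := sm k i ltac:(clear -im ki; lia); clear -a1 a2 q1 q2 ka ka'; order.
  move: a1 a2; rewrite aj => a1 a2.
  by have := qlt1 j i jm im a1 => ji; have := qlt j i ltac:(lia); order.
have [rR _ [diag0 diag1]] := lab.
have /choice[ka kaP] : forall i, exists k, (i <= m)%N -> r k = q i.
  move=> i; case: (leqP i m) => im; last by exists 0.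
  by have := qrec i im; rewrite -rR => -[k _ rk]; exists k.
have kalt i : (i < m)%N -> (ka i < ka i.+1)%R.
  move=> im; rewrite ltNge; apply/negP => /south_east_le[].
  rewrite !kaP//; last lia.
  by have := qlt i i.+1 ltac:(lia); order.
have kaS i : (i < m)%N -> ka i.+1 = ka i + 1.
  move=> im; apply/eqP; rewrite eq_le; apply/andP; split; last by have := kalt i im; lia.
  rewrite leNgt; apply/negP => lt.
  have /andP[b1 b2] : south_east (r (ka i)) (r (ka i + 1)) by apply: south_east_lt; lia.
  have /andP[c1 c2] := south_east_lt lt.
  move: b1 b2 c1 c2; rewrite !kaP//; last lia; move=> b1 b2 c1 c2.
  have [_ q1 q2] := qP i ltac:(lia); have [_ q1' q2'] := qP i.+1 im.
  have [j jm rj] : exists2 j, (j <= m)%N & r (ka i + 1) = q j.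
    have ax : from_axis s i <= (q i).1.
      by case: (i) q1 => [|i']/= ?; have := D1 0%N isT; order.
    apply: (incell _ i) => //; [exact: record_in|order|order|order].
  move: b1 c1; rewrite rj => /(qlt1 _ _ (ltnW im) jm) ij /(qlt1 _ _ jm im).
  by rewrite ltnS leqNgt ij.
have ka0 : ka 0%N = 0.
  have [_ q1 q2] := qP 0%N isT; have [_ q1' q2'] := qP 1%N m0.
  apply/eqP; rewrite eq_le; apply/andP; split; rewrite leNgt; apply/negP => lt.
    have [] := @south_east_le 1 (ka 0%N) ltac:(clear -lt; lia); rewrite kaP//.
    by clear -q1 q2 diag1 D3; order.
  have [] := @south_east_le (ka 1%N) 0 ltac:(have := kaS 0%N m0; clear -lt; lia).
  by rewrite kaP//; clear -q1' q2' diag0 D4; order.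
have kaE i : (i <= m)%N -> ka i = i%:Z.
  by elim: i => // i IH im; rewrite kaS// IH; lia.
move=> i im; have := kaP i im; rewrite kaE// => ->.
by have [_ ? ?] := qP i im; split; rewrite /= in_itv.
Qed.

End InBoxes.
End Config.
End Staircase.

(** * Counts of a Poisson process *)

Section PoissonCounts.
Context (R : realType) d (T : measurableType d) (P : probability T R).
Variable N : T -> set (R * R).
Hypothesis pp : poisson_process P N.

Lemma measurable_count B (D : set (\bar R)) : measurable B -> measurable D ->
  measurable (@atom_count _ T R N B @^-1` D).
Proof.
move=> mB mD; rewrite -[X in measurable X]setTI.
exact: (poisson_measurable pp mB).
Qed.

Lemma poisson_void B (v : R) : measurable B -> B `<=` quadrant -> area B = v%:E ->
  P (atom_count N B @^-1` [set 0%:R%:E]) = (expR (- v))%:E.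
Proof.
move=> mB Bq Bv; rewrite (poisson_law pp)// Bv ?ltry//=.
by rewrite expr0 fact0 divr1 mul1r.
Qed.

Lemma poisson_single B (v : R) : measurable B -> B `<=` quadrant -> area B = v%:E ->
  P (atom_count N B @^-1` [set 1%:R%:E]) = (v * expR (- v))%:E.
Proof.
move=> mB Bq Bv; rewrite (poisson_law pp)// Bv ?ltry//=.
by rewrite expr1 divr1.
Qed.

Lemma poisson_nonvoid_le B (v : R) : measurable B -> B `<=` quadrant ->
  area B = v%:E -> (P (atom_count N B @^-1` (~` [set 0%:R%:E])) <= v%:E)%E.
Proof.
move=> mB Bq Bv; rewrite -preimage_setC probability_setC; last exact: measurable_count.
rewrite (poisson_void mB Bq Bv) -EFinB lee_fin lerBlDr -lerBlDl.
by have := expR_ge1Dx (- v); lra.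
Qed.

Lemma measurable_quadrant : measurable (@quadrant R).
Proof.
rewrite (_ : quadrant = `[0, +oo[ `*` `[0, +oo[); first exact: measurableX.
by apply/seteqP; split => -[x y] [] /=; rewrite ?in_itv/= ?andbT.
Qed.

Lemma poisson_off_diagonal : {ae P, forall w a, N w a -> a.1 <> a.2}.
Proof.
pose B := [set a : R * R | a.1 = a.2] `&` quadrant.
have mB : measurable B by apply: measurableI; [exact: measurable_diagonal|exact: measurable_quadrant].
have B0 : area B = 0%:E.
  apply/eqP; rewrite eq_le area_ge0 andbT.
  rewrite (le_trans (le_area mB (@measurable_diagonal R) _)) ?area_diagonal//.
  exact: subIsetl.
have mC := measurable_count mB (emeasurable_set1 (0%:R%:E : \bar R)).
exists (~` (atom_count N B @^-1` [set 0%:R%:E])); split; first exact: measurableC.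
- rewrite probability_setC// (poisson_void mB _ B0) ?oppr0 ?expR0 ?subee//.
  exact: subIsetr.
- move=> w; apply: contra_not => /= /counting_eq0 NB0 a Na aa.
  suff : (N w `&` B) a by rewrite NB0.
  by split => //; split => //; exact: (poisson_sub pp Na).
Qed.

(** The Poisson weights sum to 1, so the number of atoms in each of countably many
    squares is almost surely finite. *)
Lemma poisson_locally_finite :
  {ae P, forall w a, N w a -> finite_set (N w `&` (`[0, a.1] `*` `[0, a.2]))}.
Proof.
have : {ae P, forall w (K : nat), finite_set (N w `&` (`[0, K.+1%:R] `*` `[0, K.+1%:R]))}.
  apply: ae_foralln => K; pose B : set (R * R) := `[0, K.+1%:R] `*` `[0, K.+1%:R].
  have mB : measurable B by exact: measurableX.
  have Bq : B `<=` quadrant.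
    by move=> a []; rewrite /= !in_itv/= => /andP[? _] /andP[? _].
  pose v : R := K.+1%:R * K.+1%:R.
  have v0 : 0 < v by rewrite mulr_gt0.
  have Bv : area B = v%:E by rewrite [LHS]area_rectangle ?subr0.
  have mF k : measurable (atom_count N B @^-1` [set k%:R%:E]).
    exact: measurable_count.
  have PU : P (\bigcup_k (atom_count N B @^-1` [set k%:R%:E])) = 1%E.
    rewrite measure_semi_bigcup//; last 2 first.
    - move=> i j _ _ [w []] /= -> [] /eqP; rewrite eqr_nat => /eqP //.
    - exact: bigcupT_measurable.
    have <- : (\esum_(k in [set: nat]) (poisson_pmf v k)%:E = 1)%E.
      by have := probability_setT (poisson_prob v 0); rewrite /= /poisson_prob v0.
    rewrite -nneseries_esumT; last by move=> *; rewrite lee_fin poisson_pmf_ge0.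
    apply: eq_eseriesr => k _.
    rewrite [LHS](poisson_law pp mB Bq) ?Bv ?ltry//=.
    by rewrite /poisson_pmf v0.
  exists (~` (\bigcup_k (atom_count N B @^-1` [set k%:R%:E]))); split.
  - by apply: measurableC; exact: bigcupT_measurable.
  - rewrite [LHS]probability_setC; last exact: bigcupT_measurable.
    by rewrite [X in (_ - X)%E]PU subee.
  - by move=> w; apply: contra_not => -[k _ /= /counting_finite].
apply: filterS => w fin a Na.
pose K := (Num.truncn a.1 + Num.truncn a.2)%N.
apply: (sub_finite_set _ (fin K)) => p [Np []]; rewrite /= !in_itv/=.
move=> /andP[p10 p1] /andP[p20 p2]; split => //; split; rewrite /= ?p10 ?p20/=.
  apply: (le_trans p1); apply: le_trans (ltW (truncnS_gt _)) _.
  by rewrite ler_nat ltnS leq_addr.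
apply: (le_trans p2); apply: le_trans (ltW (truncnS_gt _)) _.
by rewrite ler_nat ltnS leq_addl.
Qed.

End PoissonCounts.

(** * Probability of finding records in given cells *)

Lemma lee_prod_nneg (R : realType) (I : finType) (f g : I -> \bar R) :
  (forall i, 0 <= f i <= g i)%E -> (\prod_i f i <= \prod_i g i)%E.
Proof.
move=> fg; suff /andP[] : (0 <= \prod_i f i <= \prod_i g i)%E by [].
elim/big_ind2 : _ => [|x1 x2 y1 y2 /andP[? ?] /andP[? ?]|i _]; last exact: fg.
  by rewrite lee_fin ler01 lexx.
by rewrite mule_ge0//= lee_pmul.
Qed.

Section StaircaseAreas.
Context (R : realType).
Variables (m : nat) (s s' y y' : nat -> R).
Hypothesis desc : descending m s s' y y'.
Hypothesis m0 : (0 < m)%N.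

Definition cell_area k : R := (s' k - s k) * (y' k - y k).
Definition outer_area : R := \sum_(k < m) (s' k.+1 - from_axis s k) * y' k.
Definition inner_area : R := \sum_(k < m) (s k.+1 - from_axis s' k) * y k.

Lemma measurable_cell k : measurable (cell s s' y y' k).
Proof. exact: measurableX. Qed.

Lemma measurable_outer_step k : measurable (outer_step s s' y' k).
Proof. exact: measurableX. Qed.

Lemma measurable_inner_step k : measurable (inner_step s s' y k).
Proof. exact: measurableX. Qed.

Lemma cell_area_ge0 k : (k <= m)%N -> 0 <= cell_area k.
Proof.
have [D1 _ _ _] := desc; move=> /D1[? ? ? ?].
by rewrite mulr_ge0// subr_ge0.
Qed.

Lemma area_cell k : (k <= m)%N -> area (cell s s' y y' k) = (cell_area k)%:E.
Proof. by have [D1 _ _ _] := desc; move=> /D1[? ? ? ?]; rewrite [LHS]area_rectangle. Qed.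

Lemma from_axis_le_self k : 0 <= s k -> from_axis s k <= s k.
Proof. by case: k. Qed.

Lemma from_axis_le k : (k < m)%N ->
  [/\ 0 <= from_axis s k, from_axis s k <= s' k.+1,
      0 <= from_axis s' k & from_axis s' k <= s k.+1].
Proof.
have [D1 D2 _ _] := desc; move=> km.
have := D1 k.+1 km; have := D1 k (ltnW km); have := D2 k km.
by case: k km => [|k]/= km; order.
Qed.

Lemma area_outer_step k : (k < m)%N ->
  area (outer_step s s' y' k) = ((s' k.+1 - from_axis s k) * y' k)%:E.
Proof.
have [D1 _ _ _] := desc; move=> km; have [? ? _ _] := from_axis_le km.
have [? ? ? ?] := D1 k (ltnW km).
by rewrite [LHS]area_rectangle ?subr0//; order.
Qed.

Lemma area_inner_step k : (k < m)%N ->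
  area (inner_step s s' y k) = ((s k.+1 - from_axis s' k) * y k)%:E.
Proof.
have [D1 _ _ _] := desc; move=> km; have [_ _ ? ?] := from_axis_le km.
have [? ? ? ?] := D1 k (ltnW km).
by rewrite [LHS]area_rectangle ?subr0.
Qed.

Lemma cell_quadrant k : (k <= m)%N -> cell s s' y y' k `<=` quadrant.
Proof.
have [D1 _ _ _] := desc; move=> /D1[? ? ? ?] a [].
rewrite /= !in_itv/= => ? ?; split; order.
Qed.

Lemma outer_step_quadrant k : (k < m)%N -> outer_step s s' y' k `<=` quadrant.
Proof.
move=> km; have [? ? _ _] := from_axis_le km; move=> a [].
by rewrite /= !in_itv/= => ? ?; split; order.
Qed.

Lemma inner_step_quadrant k : (k < m)%N -> inner_step s s' y k `<=` quadrant.
Proof.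
move=> km; have [_ _ ? ?] := from_axis_le km; move=> a [].
by rewrite /= !in_itv/= => ? ?; split; order.
Qed.

Lemma cell_disjoint i j a : (i <= m)%N -> (j <= m)%N ->
  cell s s' y y' i a -> cell s s' y y' j a -> i = j.
Proof.
wlog ij : i j / (i <= j)%N.
  move=> H im jm ai aj; case: (leqP i j) => ij; first exact: (H i j).
  by apply/esym; apply: (H j i) => //; exact: ltnW.
move=> im jm [a1 a2] [a3 a4]; apply/eqP; move: ij; rewrite leq_eqVlt => /predU1P[->//|ij].
have := descending_lt desc (_ : i < j <= m)%N; rewrite ij jm => /(_ isT).
by move: a1 a2 a3 a4; rewrite /= !in_itv/=; order.
Qed.

Lemma inner_step_disjoint i j a : (i < m)%N -> (j < m)%N ->
  inner_step s s' y i a -> inner_step s s' y j a -> i = j.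
Proof.
wlog ij : i j / (i <= j)%N.
  move=> H im jm ai aj; case: (leqP i j) => ij; first exact: (H i j).
  by apply/esym; apply: (H j i) => //; exact: ltnW.
move=> im jm [a1 a2] [a3 a4]; apply/eqP; move: ij; rewrite leq_eqVlt => /predU1P[->//|ij].
case: j ij jm a3 a4 => // j ij jm a3 a4.
have := descending_le desc (_ : i.+1 <= j.+1 <= m)%N; rewrite ij (ltnW jm) => /(_ isT).
have [D1 _ _ _] := desc; have := D1 i.+1 im.
by move: a1 a2 a3 a4; rewrite /= !in_itv/=; order.
Qed.

Lemma cell_inner_step_disjoint i k a : (i <= m)%N -> (k < m)%N ->
  cell s s' y y' i a -> inner_step s s' y k a -> False.
Proof.
have [D1 _ _ _] := desc.
move=> im km [a1 a2] [a3 a4]; move: a1 a2 a3 a4; rewrite /= !in_itv/=.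
case: (leqP i k) => ik.
  move: ik; rewrite leq_eqVlt => /predU1P[->|ik]; first order.
  have := descending_lt desc (_ : i < k <= m)%N; rewrite ik (ltnW km) => /(_ isT).
  by have := D1 k (ltnW km); order.
move: ik; rewrite leq_eqVlt => /predU1P[<-|ik]; first order.
have := descending_lt desc (_ : k.+1 < i <= m)%N; rewrite ik im => /(_ isT).
by have := D1 k.+1 km; order.
Qed.

Lemma cell_outer i a : (i <= m)%N -> cell s s' y y' i a ->
  exists2 k, (k < m)%N & outer_step s s' y' k a.
Proof.
have [D1 D2 _ _] := desc.
move=> im [a1 a2]; move: a1 a2; rewrite /= !in_itv/=.
move: im; rewrite leq_eqVlt => /predU1P[->|im] a1 a2.
  exists m.-1; first lia.
  have := descending_lt desc (_ : m.-1 < m <= m)%N; rewrite leqnn prednK// leqnn => /(_ isT).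
  have [? _ ? _] := @from_axis_le m.-1 ltac:(lia).
  have := D1 m (leqnn _); have := D1 m.-1 (leq_pred _).
  move=> h1 h2 h3; have ? : from_axis s m.-1 <= s m.-1.
    by apply: from_axis_le_self; order.
  by split; rewrite /= in_itv/= ?prednK//; order.
exists i => //; have := D1 i (ltnW im); have := D1 i.+1 im; have := D2 i im.
move=> h1 h2 h3; have ? : from_axis s i <= s i by apply: from_axis_le_self; order.
by split; rewrite /= in_itv/=; order.
Qed.

End StaircaseAreas.

Section RecordsInCells.
Context (R : realType) d (T : measurableType d) (P : probability T R).
Variables (N : T -> set (R * R)) (r : int -> {RV P >-> (R * R)%type}).
Hypothesis pp : poisson_process P N.
Hypothesis lab : {ae P, forall w, records_labelling (N w) (fun k => r k w)}.
Variables (m : nat) (s s' y y' : nat -> R).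
Hypothesis desc : descending m s s' y y'.
Hypothesis m0 : (0 < m)%N.

Let event := [set w | forall k, (k <= m)%N -> cell s s' y y' k (r k%:Z w)].

Lemma measurable_record_event : measurable event.
Proof.
rewrite (_ : event = \bigcap_(k in `I_m.+1) (r k%:Z @^-1` cell s s' y y' k)).
  apply: fin_bigcap_measurable; first exact: finite_II.
  by move=> k _; apply: measurable_funPTI; exact: measurable_cell.
by apply/seteqP; split => w /=; move=> H k; have := H k; rewrite /= ltnS.
Qed.

(** Records in all cells require an atom in each cell and none in the inner steps.
    These sets are disjoint, hence their counts independent, and a set of area v
    holds an atom with probability at most v. *)
Lemma records_in_cells_le :
  (P event <= ((\prod_(k < m.+1) cell_area s s' y y' k) *
               expR (- inner_area m s s' y))%:E)%E.
Proof.
pose F (i : 'I_(m.+1 + m)) : set (R * R) := match fintype.split i with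
  | inl k => cell s s' y y' k | inr k => inner_step s s' y k end.
pose D (i : 'I_(m.+1 + m)) : set (\bar R) := match fintype.split i with
  | inl k => ~` [set 0%:R%:E] | inr k => [set 0%:R%:E] end.
have mF i : measurable (F i).
  by rewrite /F; case: fintype.split => k; [exact: measurable_cell|exact: measurable_inner_step].
have mD i : measurable (D i).
  by rewrite /D; case: fintype.split => k //; exact: measurableC.
have tF : trivIset setT F.
  move=> i j _ _ [a []]; rewrite /F.
  have : forall u v, fintype.split i = u -> fintype.split j = v ->
    match u with | inl k => cell s s' y y' k | inr k => inner_step s s' y k end a ->
    match v with | inl k => cell s s' y y' k | inr k => inner_step s s' y k end a -> i = j.
    move=> u v iu jv.
    rewrite -(fintype.splitK i) -(fintype.splitK j) iu jv; move: u v {iu jv} => [k|k] [l|l] ak al.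
    - by congr (fintype.unsplit (inl _)); apply: val_inj; apply: (cell_disjoint desc _ _ ak al); rewrite -ltnS.
    - by exfalso; apply: (cell_inner_step_disjoint desc _ _ ak al) => //; rewrite -ltnS.
    - by exfalso; apply: (cell_inner_step_disjoint desc _ _ al ak) => //; rewrite -ltnS.
    - by congr (fintype.unsplit (inr _)); apply: val_inj; exact: (inner_step_disjoint desc _ _ ak al).
  by move=> H; exact: H.
apply: (@le_trans _ _ (P (\bigcap_(i in [set: 'I_(m.+1 + m)]) (atom_count N (F i) @^-1` D i)))).
  apply: le_measure_ae; first exact: measurable_record_event.
    apply: fin_bigcap_measurable; first exact: finite_finset.
    by move=> i _; exact: (measurable_count pp).
  apply: filterS2 lab (poisson_locally_finite pp) => w labw fin ev i _.
  rewrite /F /D; case: fintype.split => k /=.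
    move=> /counting_eq0 NF; have km : (k <= m)%N by rewrite -ltnS.
    suff : (N w `&` cell s s' y y' k) (r k%:Z w) by rewrite NF.
    by split; [exact: (record_in labw)|exact: ev].
  apply/counting_eq0.
  exact: (inner_step_empty (@poisson_sub _ _ _ _ _ pp w) labw (ltn_ord k) ev fin).
rewrite (poisson_independent pp)//.
rewrite big_split_ord/= EFinM; apply: lee_pmul.
- by apply: prode_ge0 => k _; exact: measure_ge0.
- by apply: prode_ge0 => k _; exact: measure_ge0.
- rewrite -prodEFin; apply: lee_prod_nneg => k; rewrite measure_ge0/=.
  have km : (k <= m)%N by rewrite -ltnS.
  have -> : F (lshift m k) = cell s s' y y' k by rewrite /F (fintype.unsplitK (inl k)).
  have -> : D (lshift m k) = ~` [set 0%:R%:E] by rewrite /D (fintype.unsplitK (inl k)).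
  apply: (poisson_nonvoid_le pp); [exact: measurable_cell|exact: (cell_quadrant desc)|].
  exact: (area_cell desc).
- rewrite (eq_bigr (fun k : 'I_m => (expR (- ((s k.+1 - from_axis s' k) * y k)))%:E)).
    by rewrite prodEFin -expR_sum -sumrN.
  move=> k _.
  have -> : F (rshift m.+1 k) = inner_step s s' y k by rewrite /F (fintype.unsplitK (inr k)).
  have -> : D (rshift m.+1 k) = [set 0%:R%:E] by rewrite /D (fintype.unsplitK (inr k)).
  apply: (poisson_void pp); [exact: measurable_inner_step|exact: (inner_step_quadrant desc)|].
  exact: (area_inner_step desc).
Qed.

(** One atom in each cell and none in the rest of the outer steps are enough. A
    cell of area v contributes v exp (- v); the exponential factors of the cells
    and of the rest combine into that of the area of their union, which is at
    most the sum of the areas of the outer steps. *)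
Lemma records_in_cells_ge :
  (((\prod_(k < m.+1) cell_area s s' y y' k) *
     expR (- outer_area m s s' y'))%:E <= P event)%E.
Proof.
pose Outer := \bigcup_(k in `I_m) outer_step s s' y' k.
pose Cells := \bigcup_(i in `I_m.+1) cell s s' y y' i.
pose Rest := Outer `\` Cells.
have mOuter : measurable Outer.
  apply: fin_bigcup_measurable; first exact: finite_II.
  by move=> k _; exact: measurable_outer_step.
have mCells : measurable Cells.
  apply: fin_bigcup_measurable; first exact: finite_II.
  by move=> k _; exact: measurable_cell.
have mRest : measurable Rest by exact: measurableD.
have Restq : Rest `<=` quadrant.
  by move=> a [[k /= km ak] _]; exact: (outer_step_quadrant desc km ak).
have OuterE : (area Outer <= (outer_area m s s' y')%:E)%E.
  rewrite /Outer bigcup_mkord.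
  apply: le_trans (area_bigsetU_le _ (measurable_outer_step _ _ _)) _.
  rewrite -sumEFin; apply: lee_sum => k _.
  by rewrite (area_outer_step desc).
(* The index m.+1 is that of the rest of the outer steps. *)
pose F (i : 'I_m.+2) : set (R * R) := if (i <= m)%N then cell s s' y y' i else Rest.
pose D (i : 'I_m.+2) : set (\bar R) := if (i <= m)%N then [set 1%:R%:E] else [set 0%:R%:E].
have mF i : measurable (F i) by rewrite /F; case: ifP => // _; exact: measurable_cell.
have mD i : measurable (D i) by rewrite /D; case: ifP.
have tF : trivIset setT F.
  have cr i (im : (i <= m)%N) a : cell s s' y y' i a -> ~ Rest a.
    by move=> ai [_]; apply; exists i.
  move=> i j _ _ [a []]; rewrite /F; case: leqP => im; case: leqP => jm ai aj.
  - by apply: val_inj; exact: (cell_disjoint desc im jm ai aj).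
  - by have := cr _ im _ ai aj.
  - by have := cr _ jm _ aj ai.
  - by apply: val_inj => /=; have := ltn_ord i; have := ltn_ord j; lia.
have wid (k : 'I_m.+1) : F (widen_ord (leqnSn m.+1) k) = cell s s' y y' k.
  by rewrite /F/= -ltnS ltn_ord.
have widD (k : 'I_m.+1) : D (widen_ord (leqnSn m.+1) k) = [set 1%:R%:E].
  by rewrite /D/= -ltnS ltn_ord.
have mxF : F ord_max = Rest by rewrite /F/= ltnn.
have mxD : D ord_max = [set 0%:R%:E] by rewrite /D/= ltnn.
have Restfin : area Rest \is a fin_num.
  rewrite ge0_fin_numE ?area_ge0//; apply: le_lt_trans (ltry (outer_area m s s' y')).
  apply: le_trans OuterE; apply: le_area => //; exact: subDsetl.
have total : \sum_(k < m.+1) cell_area s s' y y' k + fine (area Rest) <= outer_area m s s' y'.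
  rewrite -lee_fin EFinD fineK// -sumEFin; apply: le_trans OuterE.
  rewrite (_ : (_ + _)%E = \sum_i area (F i))%E; last first.
    rewrite [RHS]big_ord_recr/= mxF; congr (_ + _)%E; apply: eq_bigr => k _.
    by rewrite wid (area_cell desc)// -ltnS.
  rewrite -area_finite_bigcup//; apply: le_area => //.
    by apply: fin_bigcup_measurable => //; exact: finite_finset.
  move=> a [i _]; rewrite /F; case: leqP => im; last by case.
  by move=> /(cell_outer desc m0 im)[k km ak]; exists k.
apply: (@le_trans _ _ (P (\bigcap_(i in [set: 'I_m.+2]) (atom_count N (F i) @^-1` D i)))).
  rewrite (poisson_independent pp)// [leRHS]big_ord_recr/= mxF mxD.
  rewrite (poisson_void pp mRest Restq (esym (fineK Restfin))).
  rewrite (eq_bigr (fun k : 'I_m.+1 =>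
      (cell_area s s' y y' k * expR (- cell_area s s' y y' k))%:E)); last first.
    move=> k _; rewrite wid widD; have km : (k <= m)%N by rewrite -ltnS.
    by apply: (poisson_single pp); [exact: measurable_cell|
      exact: (cell_quadrant desc)|exact: (area_cell desc)].
  rewrite prodEFin -EFinM lee_fin [in leRHS]big_split/= -expR_sum sumrN -mulrA -expRD.
  rewrite ler_wpM2l//; last by rewrite ler_expR; lra.
  by apply: prodr_ge0 => k _; apply: (cell_area_ge0 desc); rewrite -ltnS.
apply: le_measure_ae; last 2 first.
- exact: measurable_record_event.
- apply: filterS lab => w labw H k km.
  apply: (cell_records (@poisson_sub _ _ _ _ _ pp w) labw desc m0 _ _ km).
    move=> i im; have i2 : (i < m.+2)%N by lia.
    have := H (Ordinal i2) Logic.I; rewrite /F /D/= im => /counting_eq1[q [Nq Qq] qU].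
    by exists q.
  move=> a j jm Na aj; apply: contrapT => nQ.
  have : D ord_max (atom_count N (F ord_max) w) := H ord_max Logic.I.
  rewrite mxF mxD => /counting_eq0 NR0.
  have : (N w `&` Rest) a; last by rewrite NR0.
  split => //; split; first by exists j.
  by move=> [i /= im ai]; apply: nQ; exists i.
- apply: fin_bigcap_measurable; first exact: finite_finset.
  by move=> i _; exact: (measurable_count pp).
Qed.

End RecordsInCells.

(** * One step of the chain of records *)

Lemma measurable_funV (R : realType) d (T : measurableType d) (f : T -> R) :
  measurable_fun setT f -> measurable_fun setT (fun x => (f x)^-1).
Proof.
move=> mf; rewrite (_ : (fun _ => _) = (fun x => f x * ((f x ^+ 2) `^ (-1)))).
  apply: measurable_funM => //.
  apply: (measurableT_comp (measurable_powR _)).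
  exact: measurable_funX.
(* With the junk value 0^-1 = 0, the formula x^-1 = x / x ^+ 2 holds at 0. *)
apply/funext => x; rewrite powR_inv1 ?sqr_ge0//.
have [->|fx0] := eqVneq (f x) 0; first by rewrite invr0 mul0r.
by rewrite expr2 invfM mulrA divff// mul1r.
Qed.

Section DriverSections.
Context (R : realType).
Local Notation driver := (driver R).

Lemma ae_product d1 d2 (T1 : measurableType d1) (T2 : measurableType d2)
    (P1 : probability T1 R) (P2 : probability T2 R) (A1 : set T1) (A2 : set T2) :
  {ae P1, forall w, A1 w} -> {ae P2, forall w, A2 w} ->
  {ae product_probability P1 P2, forall w, A1 w.1 /\ A2 w.2}.
Proof.
move=> [B1 [mB1 B10 AB1]] [B2 [mB2 B20 AB2]].
exists ((B1 `*` setT) `|` (setT `*` B2)); split.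
- by apply: measurableU; exact: measurableX.
- apply/eqP; rewrite eq_le measure_ge0 andbT.
  apply: le_trans (measureU2 _ _ _) _; try exact: measurableX.
  rewrite [X in (X + _)%E](product_probabilityX _ _ mB1)//.
  rewrite [X in (_ + X)%E](product_probabilityX _ _ _ mB2)//.
  by rewrite [X in (X * _)%E]B10 [X in (_ + _ * X)%E]B20 mul0e mule0 adde0.
- move=> [w1 w2] /= /not_andP[nA|nA]; [left|right]; split => //=.
    exact: AB1.
  exact: AB2.
Qed.

Lemma unit_uniform_ae : {ae unit_uniform R, forall u, 0 < u < 1}.
Proof.
pose B : set R := (~` `]0, 1]) `|` [set 1].
have mB : measurable (~` `]0, 1] : set R) by exact: measurableC.
exists B; split; first exact: measurableU.
- apply/eqP; rewrite eq_le measure_ge0 andbT.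
  apply: le_trans (measureU2 _ _ _) _ => //.
  rewrite [X in (X + _)%E]probability_setC// unit_uniformE// subr0 subee// add0e.
  have U1 : unit_uniform R [set 1] = 0%E.
    exact: (integral_set1 (fun x => (uniform_pdf 0 1 x)%:E)).
  by rewrite [leLHS]U1.
- move=> u /= nu; have [->|u1] := eqVneq u 1; [by right|left => /= u01].
  apply: nu; move: u01; rewrite /= in_itv/= => /andP[-> ?]/=.
  by rewrite lt_neqAle u1.
Qed.

Lemma unit_exponential_ae : {ae unit_exponential R, forall e, 0 < e}.
Proof.
exists (`]-oo, 0[ `|` [set 0]); split; first exact: measurableU.
- apply/eqP; rewrite eq_le measure_ge0 andbT.
  apply: le_trans (measureU2 _ _ _) _ => //.
  have E0 : unit_exponential R [set 0] = 0%E.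
    exact: (integral_set1 (fun x => (exponential_pdf 1 x)%:E)).
  rewrite [X in (_ + X)%E]E0 adde0.
  suff EN : unit_exponential R `]-oo, 0[%classic = 0%E by rewrite [leLHS]EN.
  apply: integral0_eq => x; rewrite /= in_itv/= => x0.
  by rewrite lt0_exponential_pdf.
- move=> e /= /negP; rewrite -leNgt le_eqVlt => /predU1P[->|e0]; [by right|left].
  by rewrite /= in_itv.
Qed.

Lemma driver_ae : {ae driver, forall p, 0 < p.1 /\ 0 < p.2 < 1}.
Proof.
exact: (ae_product unit_exponential_ae unit_uniform_ae).
Qed.

(** The next record after (t, x) has density exp (- x (s - t)) at time s, on values
    in [0, x]; the exponent is the area that must be free of atoms. *)
Lemma driver_next_record (t x s s' y y' : R) :
  0 < x -> t <= s -> s <= s' -> 0 <= y -> y <= y' -> y' <= x ->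
  (((s' - s) * (y' - y) * expR (- (x * (s' - t))))%:E <=
   driver [set p | (s < t + p.1 / x <= s')%R /\ (y < x * p.2 <= y')%R] <=
   ((s' - s) * (y' - y) * expR (- (x * (s - t))))%:E)%E.
Proof.
move=> x0 ts ss' y0 yy' y'x.
rewrite (_ : [set _ | _] = `]x * (s - t), x * (s' - t)] `*` `]y / x, y' / x]); last first.
  have q1 (u : R) : (y < x * u <= y') = (y / x < u <= y' / x).
    by rewrite ltr_pdivrMr// ler_pdivlMr// mulrC.
  have q2 (e : R) : (s < t + e / x <= s') = (x * (s - t) < e <= x * (s' - t)).
    by rewrite -ltrBlDl ltr_pdivlMr// -lerBrDl ler_pdivrMr// ![(_ - t) * x]mulrC.
  by apply/seteqP; split => -[e u]; rewrite /= !in_itv/= q1 q2 => -[].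
rewrite product_probabilityX//.
have xV : 0 <= x^-1 by rewrite invr_ge0 ltW.
rewrite [X in (_ * X)%E]unit_uniformE; last 3 first.
- by rewrite mulr_ge0.
- by rewrite ler_wpM2r.
- by rewrite ler_pdivrMr// mul1r.
have c0 : 0 <= y' / x - y / x by rewrite subr_ge0 ler_wpM2r.
have bnd : 0 <= x * (s - t) <= x * (s' - t).
  by rewrite (mulr_ge0 (ltW x0)) ?subr_ge0//= ler_pM2l ?lerD2r.
have /andP[lo hi] := unit_exponential_bounds bnd.
have E1 (c : R) : (s' - s) * (y' - y) * c =
    (y' / x - y / x) * ((x * (s' - t) - x * (s - t)) * c).
  by field; rewrite gt_eqF.
by rewrite !E1 ![((_ / x - _) * _)%:E]EFinM [X in (_ <= X <= _)%E]muleC !lee_wpmul2l.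
Qed.

(** From the level w, the level w + E = v has density exp (w - v) and the following
    one, U v, has density 1 / v on [0, v]. *)
Lemma driver_next_level (w b b' c c' : R) :
  0 <= w -> w <= b -> 0 < b -> b <= b' -> 0 <= c -> c <= c' -> c' <= b ->
  (((b' - b) * (c' - c) * (expR (- (b' - w)) / b'))%:E <=
   driver [set p | (b < w + p.1 <= b')%R /\ (c < p.2 * (w + p.1) <= c')%R] <=
   ((b' - b) * (c' - c) * (expR (- (b - w)) / b))%:E)%E.
Proof.
move=> w0 wb b0 bb' c0 cc' c'b.
have b'0 : 0 < b' by exact: lt_le_trans bb'.
set D := [set p : R * R | _].
have mD : measurable D.
  pose f (p : R * R) := w + p.1; pose g (p : R * R) := p.2 * (w + p.1).
  have mf : measurable_fun setT f by exact: measurable_funD.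
  have mg : measurable_fun setT g by exact: measurable_funM.
  rewrite (_ : D = f @^-1` `]b, b'] `&` g @^-1` `]c, c']).
    by apply: measurableI; rewrite -[X in measurable X]setTI; [exact: mf|exact: mg].
  by apply/seteqP; split => p; rewrite /= !in_itv.
pose A : set R := `]b - w, b' - w]%classic.
have AE e : A e = (b < w + e <= b').
  by rewrite /A /= in_itv/= ltrBlDl lerBrDl.
have sec e : A e -> xsection D e = `]c / (w + e), c' / (w + e)]%classic.
  rewrite AE => be; have we : 0 < w + e by have /andP[? _] := be; exact: lt_trans b0 _.
  apply/seteqP; split => u; rewrite /xsection /D/= inE/= in_itv/= ltr_pdivrMr// ler_pdivlMr//.
  by case.
have /andP[lo hi] := @unit_exponential_bounds R (b - w) (b' - w) ltac:(lra).
have cc : 0 <= c' - c by rewrite subr_ge0.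
have : (((c' - c) / b')%:E * unit_exponential R A <= driver D <=
        ((c' - c) / b)%:E * unit_exponential R A)%E.
  apply: product_probability_bounds => //.
  - exact: measurable_itv.
  - by rewrite divr_ge0// ltW.
  - move=> e Ae; rewrite (sec _ Ae); move: Ae; rewrite AE => /andP[be be'].
    have we : 0 < w + e by exact: lt_trans be.
    have weV : 0 <= (w + e)^-1 by rewrite invr_ge0 ltW.
    rewrite unit_uniformE; last 3 first.
    + by rewrite mulr_ge0.
    + by rewrite ler_wpM2r.
    + by rewrite ler_pdivrMr// mul1r (le_trans c'b)// ltW.
    rewrite -mulrBl !lee_fin !ler_wpM2l// lef_pV2//; exact: ltW.
  - move=> e; rewrite AE => nAe; apply/seteqP; split => // u.
    by rewrite /xsection /D/= inE/= => -[].
move=> /andP[H1 H2]; apply/andP; split.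
- apply: le_trans H1; rewrite (_ : _ * _ = (c' - c) / b' * ((b' - w - (b - w)) * expR (- (b' - w)))).
    by rewrite [leLHS]EFinM lee_wpmul2l// lee_fin divr_ge0// ltW.
  by field; rewrite gt_eqF.
- apply: (le_trans H2); rewrite (_ : _ * (expR _ / b) = (c' - c) / b * ((b' - w - (b - w)) * expR (- (b - w)))).
    by rewrite [leRHS]EFinM lee_wpmul2l// lee_fin divr_ge0// ltW.
  by field; rewrite gt_eqF.
Qed.

End DriverSections.

(** * Finite sequences of points as vectors *)

Section PointVectors.
Context (R : realType).
Variable M : nat.
Local Notation I := (bool * 'I_M.+1)%type.

(** The times and values of finitely many points, as one vector of reals; the
    boolean [true] selects times. *)
Definition flatten_points (z : nat -> R * R) (i : I) : R :=
  if i.1 then (z i.2).1 else (z i.2).2.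

Definition point_of (v : I -> R) (k : nat) : R * R :=
  (v (true, inord k), v (false, inord k)).

(** Times increase, values decrease, and the line t = x passes between the points
    of index 0 and 1. *)
Definition staircase_order : rel I := fun i j =>
  match i, j with
  | (true, k), (true, l) => l == k.+1 :> nat
  | (false, k), (false, l) => k == l.+1 :> nat
  | (true, k), (false, l) => (k == 0 :> nat) && (l == 0 :> nat)
  | (false, k), (true, l) => (k == 1 :> nat) && (l == 1 :> nat)
  end.

Lemma flatten_pointsK z k : (k <= M)%N -> point_of (flatten_points z) k = z k.
Proof.
by move=> kM; rewrite /point_of /flatten_points/= inordK//; case: (z k).
Qed.

Lemma chain_flatten z :
  (forall k, (k <= M)%N -> 0 < (z k).1 /\ 0 < (z k).2) ->
  (forall k, (k < M)%N -> (z k).1 < (z k.+1).1 /\ (z k.+1).2 < (z k).2) ->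
  (z 0%N).1 < (z 0%N).2 -> (z 1%N).2 < (z 1%N).1 ->
  chain staircase_order (flatten_points z).
Proof.
move=> zpos zdec z0 z1; split=> [[[] k]|[[] k] [[] l]]; rewrite /flatten_points /=.
- by have [] := zpos k (leq_ord k).
- by have [] := zpos k (leq_ord k).
- move=> /eqP lk; have kM : (k < M)%N by have := ltn_ord l; lia.
  by have [+ _] := zdec k kM; rewrite lk.
- by move=> /andP[/eqP-> /eqP->].
- by move=> /andP[/eqP-> /eqP->].
- move=> /eqP kl; have lM : (l < M)%N by have := ltn_ord k; lia.
  by have [_ +] := zdec l lM; rewrite kl.
Qed.

Section BoxSides.
Variable b : I -> R * R.
Definition side (c upper : bool) (k : nat) : R :=
  if upper then (b (c, inord k)).2 else (b (c, inord k)).1.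
End BoxSides.

Lemma separated_descending (b Q : I -> R * R) : (0 < M)%N ->
  separated staircase_order Q -> sub_box b Q ->
  descending M (side b true false) (side b true true)
               (side b false false) (side b false true).
Proof.
move=> M0 [Q0 Qe] bQ.
have bb i : (b i).1 <= (b i).2 by have [] := bQ i.
have b0 i : 0 <= (b i).1.
  by have [? _ _] := bQ i; have /andP[? _] := Q0 i; lra.
have be i j : staircase_order i j -> (b i).2 <= (b j).1.
  move=> /Qe; have [_ _ ?] := bQ i; have [? _ _] := bQ j; lra.
split => [k kM|k kM||]; rewrite /side /=.
- by split.
- by split; apply: be; rewrite /= !inordK//; lia.
- by apply: be; rewrite /= !inordK.
- by apply: be; rewrite /= !inordK.
Qed.

Lemma box_flattenE (b : I -> R * R) z : box b (flatten_points z) <->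
  forall k, (k <= M)%N -> cell (side b true false) (side b true true)
               (side b false false) (side b false true) k (z k).
Proof.
split=> [bz k kM|H [[] k]].
- split; rewrite /= in_itv/=.
    by have := bz (true, inord k); rewrite /flatten_points/= inordK.
  by have := bz (false, inord k); rewrite /flatten_points/= inordK.
- by have [+ _] := H k (leq_ord k); rewrite /= in_itv/= /side inord_val.
- by have [_ +] := H k (leq_ord k); rewrite /= in_itv/= /side inord_val.
Qed.

(** The exponents in the two estimates for records differ by the order of the size
    of the box, uniformly on the subboxes of a given box. *)
Lemma area_gap (b Q : I -> R * R) (K : R) : (0 < M)%N ->
  separated staircase_order Q -> sub_box b Q -> (forall i, (Q i).2 <= K) ->
  outer_area M (side b true false) (side b true true) (side b false true) <=
  3 * K * M%:R * box_girth b +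
  inner_area M (side b true false) (side b true true) (side b false false).
Proof.
move=> M0 sepQ bQ QK; have desc := separated_descending M0 sepQ bQ.
have K0 : 0 <= K.
  by have [/(_ (true, ord0)) /andP[? ?] _] := sepQ; have := QK (true, ord0); lra.
have gi i : (b i).2 - (b i).1 <= box_girth b.
  rewrite /box_girth (bigD1 i)//= lerDl sumr_ge0// => j _.
  by have [_ ? _] := bQ j; rewrite subr_ge0.
have bK i : (b i).2 <= K by have [_ _ ?] := bQ i; have := QK i; lra.
rewrite -lerBlDr /outer_area /inner_area -sumrB.
have -> : 3 * K * M%:R * box_girth b = \sum_(k < M) (3 * K * box_girth b).
  by rewrite sumr_const card_ord -mulr_natr; ring.
apply: ler_sum => k _.
have [D1 D2 _ _] := desc; have [f1 f2 f3 f4] := from_axis_le desc (ltn_ord k).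
have [s0 ss y0 yy] := D1 k (ltnW (ltn_ord k)).
have [s0' ss' _ _] := D1 k.+1 (ltn_ord k).
have g1 := gi (true, inord k.+1); have g2 := gi (false, inord k).
have g3 := gi (true, inord k); have k1 := bK (true, inord k.+1).
have k2 := bK (false, inord k).
have fa : from_axis (side b true true) k - from_axis (side b true false) k
    <= box_girth b.
  case: (nat_of_ord k) g3 => [_|k' //].
  by rewrite /= subrr (le_trans _ g1)// subr_ge0.
move: f1 f2 f3 f4 s0 ss y0 yy s0' ss' fa; rewrite {D1 D2}.
set f := from_axis _ k; set f' := from_axis _ k; rewrite /side.
set G := box_girth b in gi g1 g2 g3 *.
move: g1 g2 k1 k2.
set a := (b (true, inord k.+1)).1; set a' := (b (true, inord k.+1)).2.
set c := (b (false, inord k)).1; set c' := (b (false, inord k)).2.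
move=> g1 g2 k1 k2 f1 f2 f3 f4 s0 ss y0 yy s0' ss' fa.
have E : (a' - f) * c' - (a - f') * c = (a' - f) * (c' - c) + c * ((a' - a) + (f' - f)) by ring.
rewrite E.
have h1 : (a' - f) * (c' - c) <= K * G.
  by apply: ler_pM; lra.
have h2 : c * ((a' - a) + (f' - f)) <= K * (G + G).
  by apply: (le_trans (ler_wpM2l y0 (_ : _ <= G + G))); [lra|apply: ler_wpM2r; lra].
lra.
Qed.

End PointVectors.

(** * Markov property of the records *)

(** The properties of the labelled records that hold almost surely; the inequality
    at index 0 is strict because no atom lies on the line t = x. *)
Definition proper_records (R : realType) (p : int -> R * R) : Prop :=
  [/\ forall k : int, 0 < (p k).1 /\ 0 < (p k).2,
      forall k : int, (p k).1 < (p (k + 1)).1 /\ (p (k + 1)).2 < (p k).2,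
      (p 0).1 < (p 0).2 & (p 1).2 < (p 1).1].

(** The bounds extend those of [records_in_cells_le] and [records_in_cells_ge] by
    one more record. *)
Lemma next_record_in_cell (R : realType) (q : R * R) (s s' y y' u u' v v' : R) :
  `]s, s']%classic q.1 -> `]y, y']%classic q.2 -> 0 <= y ->
  s' <= u -> u <= u' -> 0 <= v -> v <= v' -> v' <= y ->
  (((u' - u) * (v' - v) * expR (- (y' * (u' - s))))%:E <=
   driver R [set p | (u < q.1 + p.1 / q.2 <= u')%R /\ (v < q.2 * p.2 <= v')%R] <=
   ((u' - u) * (v' - v) * expR (- (y * (u - s'))))%:E)%E.
Proof.
rewrite /= !in_itv/= => /andP[q1 q1'] /andP[q2 q2'] y0 su uu v0 vv vy.
have /andP[lo hi] := @driver_next_record _ q.1 q.2 u u' v v'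
  ltac:(lra) ltac:(lra) uu v0 vv ltac:(lra).
have uv : 0 <= (u' - u) * (v' - v) by rewrite mulr_ge0// subr_ge0.
apply/andP; split; [apply: le_trans lo|apply: (le_trans hi)];
  by rewrite lee_fin ler_wpM2l// ler_expR lerN2; apply: ler_pM; lra.
Qed.

Section MarkovStep.
Context (R : realType) d (T : measurableType d) (P : probability T R).
Variables (N : T -> set (R * R)) (r : int -> {RV P >-> (R * R)%type}).
Hypothesis pp : poisson_process P N.
Hypothesis lab : {ae P, forall w, records_labelling (N w) (fun k => r k w)}.
Variable m : nat.
Hypothesis m0 : (0 < m)%N.
Local Notation M := m.+1.
Local Notation I := (bool * 'I_M.+1)%type.

Let X (w : T) : I -> R := flatten_points (fun k => r k%:Z w).

Definition next_record (p q : R * R) : R * R := (p.1 + q.1 / p.2, p.2 * q.2).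

(** The inverse of [next_record p]: the first component is the area of the strip
    between p and p' below p, the second one the ratio of the values. *)
Definition record_increment (p p' : R * R) : R * R :=
  (p.2 * (p'.1 - p.1), p'.2 / p.2).

Let Y (w : T * (R * R)) : I -> R := flatten_points (fun k =>
  if (k <= m)%N then r k%:Z w.1 else next_record (r m%:Z w.1) w.2).

Let mr1 k : measurable_fun setT (fun w => (r k w).1).
Proof. exact: (measurableT_comp measurable_fst). Qed.

Let mr2 k : measurable_fun setT (fun w => (r k w).2).
Proof. exact: (measurableT_comp measurable_snd). Qed.

Let mX i : measurable_fun setT (fun w => X w i).
Proof. by case: i => [[] k]; rewrite /X /flatten_points/=. Qed.

Let mY i : measurable_fun setT (fun w => Y w i).
Proof.
have mf k (f : T -> R) : measurable_fun setT f ->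
  measurable_fun setT (fun w : T * (R * R) => f w.1).
  by move=> mf'; exact: (measurableT_comp mf' measurable_fst).
have mq1 : measurable_fun setT (fun w : T * (R * R) => w.2.1).
  exact: (measurableT_comp measurable_fst measurable_snd).
have mq2 : measurable_fun setT (fun w : T * (R * R) => w.2.2).
  exact: (measurableT_comp measurable_snd measurable_snd).
case: i => [[] k]; rewrite /Y /flatten_points/=; case: leqP => _; rewrite /next_record/=.
- exact: (measurableT_comp (mr1 _) measurable_fst).
- apply: measurable_funD; first exact: (measurableT_comp (mr1 _) measurable_fst).
  apply: measurable_funM => //; apply: measurable_funV.
  exact: (measurableT_comp (mr2 _) measurable_fst).
- exact: (measurableT_comp (mr2 _) measurable_fst).
- apply: measurable_funM => //.
  exact: (measurableT_comp (mr2 _) measurable_fst).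
Qed.

Lemma records_proper : {ae P, forall w, proper_records (fun k => r k w)}.
Proof.
apply: filterS2 lab (poisson_off_diagonal pp) => w labw off; split.
- by move=> k; exact: (record_pos (@poisson_sub _ _ _ _ _ pp w) labw).
- by move=> k; have [_ /(_ k) /andP[]] := labw.
- have [_ _ [le0 _]] := labw; rewrite lt_neqAle le0 andbT; apply/eqP.
  exact/off/(record_in labw).
- by have [_ _ []] := labw.
Qed.

Let chainX : {ae P, forall w, chain (@staircase_order M) (X w)}.
Proof.
apply: filterS records_proper => w [pos dec d0 d1].
apply: chain_flatten => // k _; have kS : k.+1%:Z = k%:Z + 1 by rewrite intS addrC.
by rewrite /= kS; exact: dec.
Qed.

Let chainY : {ae product_probability P (driver R),
  forall w, chain (@staircase_order M) (Y w)}.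
Proof.
apply: filterS (ae_product records_proper (@driver_ae R)) => -[w [q1 q2]] /=.
move=> [[pos dec d0 d1] [q10 /andP[q20 q21]]].
have [t0 x0] := pos m%:Z.
apply: chain_flatten => /= [k _|k|//|]; last by rewrite m0.
  case: leqP => _ //=; split.
    by rewrite addr_gt0// divr_gt0.
  by rewrite mulr_gt0.
rewrite ltnS => km; rewrite km; case: (ltnP k m) => km'.
  have kS : k.+1%:Z = k%:Z + 1 by rewrite intS addrC.
  by rewrite /= kS; exact: dec.
have -> : k = m by apply/eqP; rewrite eqn_leq km km'.
rewrite /next_record/= ltrDl divr_gt0//=; split => //.
by rewrite -[ltRHS]mulr1 ltr_pM2l.
Qed.

Local Notation out b := (outer_area M (side b true false) (side b true true) (side b false true)).
Local Notation inn b := (inner_area M (side b true false) (side b true true) (side b false false)).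
Local Notation vol b := (\prod_(k < M.+1) cell_area (side b true false)
  (side b true true) (side b false false) (side b false true) k).

Let X_bounds (b Q : I -> R * R) : separated (@staircase_order M) Q -> sub_box b Q ->
  ((vol b * expR (- out b))%:E <= P (X @^-1` box b) <= (vol b * expR (- inn b))%:E)%E.
Proof.
move=> sepQ bQ; have desc := separated_descending (ltn0Sn m) sepQ bQ.
rewrite (_ : X @^-1` box b = [set w | forall k, (k <= M)%N ->
    cell (side b true false) (side b true true) (side b false false)
      (side b false true) k (r k%:Z w)]); last first.
  by apply/seteqP; split => w; rewrite /X/= => /box_flattenE.
by rewrite (records_in_cells_ge pp)// (records_in_cells_le pp).
Qed.

Let Y_bounds (b Q : I -> R * R) : separated (@staircase_order M) Q -> sub_box b Q ->
  ((vol b * expR (- out b))%:E <= product_probability P (driver R) (Y @^-1` box b)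
   <= (vol b * expR (- inn b))%:E)%E.
Proof.
move=> sepQ bQ; have desc := separated_descending (ltn0Sn m) sepQ bQ.
set s := side b true false in desc *; set s' := side b true true in desc *.
set y := side b false false in desc *; set y' := side b false true in desc *.
have descm : descending m s s' y y'.
  have [D1 D2 D3 D4] := desc; split => // k km; [apply: D1|apply: D2]; lia.
pose A := [set w | forall k, (k <= m)%N -> cell s s' y y' k (r k%:Z w)].
have mA : measurable A by exact: measurable_record_event.
have [D1 D2 _ _] := desc.
have [sm0 smm ym0 ymm] := D1 m (leqnSn m); have [sM0 sMM yM0 yMM] := D1 M (leqnn _).
have [smM yMm] := D2 m (leqnn _).
pose v := (s' M - s M) * (y' M - y M).
have v0 : 0 <= v by rewrite mulr_ge0// subr_ge0.
(* Once r 0, ..., r m are in their cells, only the next record is left. *)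
have secE w : xsection (Y @^-1` box b) w = if `[< A w >] then
    [set p | s M < (r m%:Z w).1 + p.1 / (r m%:Z w).2 <= s' M /\
             y M < (r m%:Z w).2 * p.2 <= y' M] else set0.
  have E p : xsection (Y @^-1` box b) w p = box b (Y (w, p)).
    by rewrite /xsection/= inE.
  case: asboolP => Aw; apply/seteqP; split => // p; rewrite E /Y.
  - by move=> /box_flattenE /(_ M (leqnn _)); rewrite ltnn /next_record => -[]; rewrite /= !in_itv.
  - move=> [p1 p2]; apply/box_flattenE => k kM /=; case: leqP => km; first exact: Aw.
    have -> : k = M by apply/eqP; rewrite eqn_leq kM km.
    by split; rewrite /= in_itv.
  - move=> /box_flattenE H; exfalso; apply: Aw => k km.
    by have := H k (leqW km); rewrite /= km.
have mYb : measurable (Y @^-1` box b) by exact: measurable_box.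
have := @product_probability_bounds _ _ _ _ _ P (driver R) A _
  (v * expR (- (y' m * (s' M - s m)))) (v * expR (- (y m * (s M - s' m)))) mA mYb.
have volE : vol b = (\prod_(k < m.+1) cell_area s s' y y' k) * v.
  by rewrite big_ord_recr.
have fa u : from_axis u m = u m by case: (m) m0.
have outE : out b = outer_area m s s' y' + y' m * (s' M - s m).
  by rewrite /outer_area big_ord_recr/= fa [X in _ + X = _]mulrC.
have innE : inn b = inner_area m s s' y + y m * (s M - s' m).
  by rewrite /inner_area big_ord_recr/= fa [X in _ + X = _]mulrC.
have Al := records_in_cells_ge pp lab descm m0.
have Ah := records_in_cells_le pp lab descm.
move=> /(_ (mulr_ge0 v0 (expR_ge0 _))) H.
have secA w : A w -> ((v * expR (- (y' m * (s' M - s m))))%:E <=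
    driver R (xsection (Y @^-1` box b) w) <=
    (v * expR (- (y m * (s M - s' m))))%:E)%E.
  move=> Aw; rewrite secE asboolT//.
  by have [tm xm] := Aw m (leqnn _); exact: next_record_in_cell.
have /andP[lo hi] := H secA (fun w nAw => ltac:(by rewrite secE asboolF)).
rewrite volE outE innE !opprD !expRD.
apply/andP; split; [apply: le_trans lo|apply: (le_trans hi)].
- rewrite [leLHS](_ : _ = ((v * expR (- (y' m * (s' M - s m))))%:E *
    ((\prod_(k < m.+1) cell_area s s' y y' k) * expR (- outer_area m s s' y'))%:E)%E).
    by rewrite lee_wpmul2l// lee_fin mulr_ge0// expR_ge0.
  by rewrite -EFinM; congr EFin; ring.
- rewrite [leRHS](_ : _ = ((v * expR (- (y m * (s M - s' m))))%:E *
    ((\prod_(k < m.+1) cell_area s s' y y' k) * expR (- inner_area m s s' y))%:E)%E).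
    by rewrite lee_wpmul2l// lee_fin mulr_ge0// expR_ge0.
  by rewrite -EFinM; congr EFin; ring.
Qed.

Let dominated_by_sandwich (f g : (I -> R * R) -> \bar R) (Q : I -> R * R) :
  separated (@staircase_order M) Q ->
  (forall b, sub_box b Q -> f b <= (vol b * expR (- inn b))%:E)%E ->
  (forall b, sub_box b Q -> (vol b * expR (- out b))%:E <= g b)%E ->
  exists C : R, forall b, sub_box b Q ->
    (f b <= (expR (C * box_girth b))%:E * g b)%E.
Proof.
move=> sepQ fh gl; pose K := \sum_i (Q i).2.
have QK i : (Q i).2 <= K.
  rewrite /K (bigD1 i)//= lerDl sumr_ge0// => j _.
  by have [/(_ j) /andP[? ?] _] := sepQ; lra.
exists (3 * K * M%:R) => b bQ.
apply: (le_trans (fh b bQ)); apply: le_trans (lee_wpmul2l _ (gl b bQ)); last first.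
  by rewrite lee_fin expR_ge0.
rewrite -EFinM lee_fin mulrCA ler_wpM2l//.
  apply: prodr_ge0 => k _; apply: (@cell_area_ge0 _ M); last by rewrite -ltnS.
  exact: (separated_descending _ sepQ bQ).
by rewrite -expRD ler_expR; have := area_gap (ltn0Sn m) sepQ bQ QK; lra.
Qed.

(** The next record may be drawn afresh from the driving law: the vector obtained
    obeys the same estimates on cells as the true records. *)
Lemma next_record_law (S : set (coord_space R I)) : measurable S ->
  P (X @^-1` S) = product_probability P (driver R) (Y @^-1` S).
Proof.
apply: (eq_law_of_box_dominated mX mY chainX chainY) => // Q sepQ;
  apply: (dominated_by_sandwich sepQ) => b bQ.
- by have /andP[] := X_bounds sepQ bQ.
- by have /andP[] := Y_bounds sepQ bQ.
- by have /andP[] := Y_bounds sepQ bQ.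
- by have /andP[] := X_bounds sepQ bQ.
Qed.

(** Markov property: the increment after r m is independent of r 0, ..., r m and
    follows the driving law. The hypothesis on S says that S does not look at the
    last point. *)
Theorem increment_independent (S : set (coord_space R I)) (G : set (R * R)) :
  measurable S -> measurable G ->
  (forall v v' : I -> R, (forall c (k : 'I_M.+1), (k <= m)%N -> v (c, k) = v' (c, k)) ->
     S v -> S v') ->
  P ([set w | S (X w)] `&` [set w | G (record_increment (r m%:Z w) (r M%:Z w))]) =
  (P [set w | S (X w)] * driver R G)%E.
Proof.
move=> mS mG Sins.
pose inc (v : coord_space R I) := record_increment (point_of v m) (point_of v M).
have minc : measurable_fun setT inc.
  rewrite /inc /record_increment /point_of /=; apply: measurable_fun_pair.
    apply: measurable_funM; first exact: measurable_coord.
    by apply: measurable_funB; exact: measurable_coord.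
  apply: measurable_funM; first exact: measurable_coord.
  by apply: measurable_funV; exact: measurable_coord.
have mS' : measurable (S `&` inc @^-1` G).
  by apply: measurableI => //; rewrite -[X in measurable X]setTI; exact: minc.
have := next_record_law mS'.
rewrite (_ : X @^-1` _ = [set w | S (X w)] `&`
    [set w | G (record_increment (r m%:Z w) (r M%:Z w))]); last first.
  by apply/seteqP; split => w /=; rewrite /inc /X !flatten_pointsK.
move=> ->.
have mSX : measurable [set w | S (X w)].
  have mXT : measurable_fun setT (X : T -> coord_space R I) by exact: measurable_vector.
  by rewrite -[X in measurable X]setTI; exact: mXT.
rewrite -(product_probabilityX P (driver R) mSX mG).
have mYT : measurable_fun setT (Y : T * (R * R) -> coord_space R I) by exact: measurable_vector.
apply: eq_measure_ae; first by rewrite -[X in measurable X]setTI; exact: mYT.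
  exact: measurableX.
apply: filterS (ae_product records_proper (@driver_ae R)) => -[w q] /= [[pos _ _ _] _].
rewrite /inc /Y !flatten_pointsK// leqnn ltnn.
rewrite (_ : record_increment _ _ = q); last first.
  have [_ /= x0] := pos m%:Z; rewrite /record_increment /next_record/=.
  case: q => q1 q2 /=; congr (_, _).
    by field; rewrite gt_eqF.
  by field; rewrite gt_eqF.
split=> -[H ?]; split => //; apply: Sins H => c k km; rewrite /X /flatten_points/= km//.
Qed.

End MarkovStep.

(** * Levels *)

Section Levels.
Context (R : realType).

(** The sequence W_1, V_1, W_2, V_2, ... with V = W + E and W' = U V, where (E, U)
    are the increments of the points z 1, z 2, ... When w0 is the product of the
    coordinates of z 1, the W are the products t x of all these points and V is
    the product of a value and of the next time; here w0 is arbitrary. *)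
Fixpoint levels (w0 : R) (z : nat -> R * R) (l : nat) : R :=
  if l is l'.+1 then
    let p := record_increment (z l'./2.+1) (z l'./2.+2) in
    if odd l' then p.2 * levels w0 z l' else levels w0 z l' + p.1
  else w0.

Lemma levels_odd w0 z k :
  levels w0 z k.*2.+1 = levels w0 z k.*2 + (record_increment (z k.+1) (z k.+2)).1.
Proof. by rewrite /= odd_double doubleK. Qed.

Lemma levels_even w0 z k :
  levels w0 z k.*2.+2 =
  (record_increment (z k.+1) (z k.+2)).2 * levels w0 z k.*2.+1.
Proof.
have -> : levels w0 z k.*2.+2 =
    (record_increment (z (k.*2.+1)./2.+1) (z (k.*2.+1)./2.+2)).2 *
    levels w0 z k.*2.+1.
  by rewrite /= odd_double.
by rewrite -[k.*2.+1]/(true + k.*2)%N half_bit_double.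
Qed.

Lemma eq_levels w0 z z' j l : (l <= j.*2)%N ->
  (forall k, (k <= j.+1)%N -> z k = z' k) -> levels w0 z l = levels w0 z' l.
Proof.
move=> + zz'; elim: l => // l IH lj /=.
by rewrite IH ?(ltnW lj)// !zz'//; lia.
Qed.

Lemma measurable_levels d (T : measurableType d) (w0 : T -> R)
    (z : T -> nat -> R * R) l :
  measurable_fun setT w0 ->
  (forall k, measurable_fun setT (fun t => (z t k).1)) ->
  (forall k, measurable_fun setT (fun t => (z t k).2)) ->
  measurable_fun setT (fun t => levels (w0 t) (z t) l).
Proof.
move=> mw0 m1 m2; elim: l => [//|l IH] /=.
case: odd; rewrite /record_increment/=.
  by apply: measurable_funM => //; apply: measurable_funM => //; exact: measurable_funV.
apply: measurable_funD => //; apply: measurable_funM => //.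
exact: measurable_funB.
Qed.

Lemma levels_pos w0 z n : 0 < w0 ->
  (forall k, (k <= n.+1)%N -> 0 < (z k).2) ->
  (forall k, (k <= n)%N -> (z k).1 < (z k.+1).1) ->
  forall l, (l <= n.*2)%N -> 0 < levels w0 z l.
Proof.
move=> w00 z2 z1; elim=> // l IH ln /=.
have := IH (ltnW ln); move: ln => + lpos.
have zl (ln : (l < n.*2)%N) : 0 < (z l./2.+1).2 by apply: z2; lia.
move=> ln; have := zl ln; case: odd => zl1; rewrite /record_increment /=.
  by rewrite mulr_gt0// divr_gt0// z2//; lia.
by rewrite addr_gt0// mulr_gt0// subr_gt0 z1//; lia.
Qed.

Lemma levels_increase w0 z k : 0 < (z k.+1).2 -> (z k.+1).1 < (z k.+2).1 ->
  levels w0 z k.*2 < levels w0 z k.*2.+1.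
Proof.
move=> x0 tt; rewrite levels_odd ltrDl /record_increment/=.
by rewrite mulr_gt0// subr_gt0.
Qed.

Lemma levels_decrease w0 z k : 0 < (z k.+1).2 -> (z k.+2).2 < (z k.+1).2 ->
  0 < levels w0 z k.*2.+1 -> levels w0 z k.*2.+2 < levels w0 z k.*2.+1.
Proof.
move=> x0 xx l0; rewrite levels_even /record_increment [ltLHS]/=.
by rewrite -[ltRHS]mul1r ltr_pM2r// ltr_pdivrMr// mul1r.
Qed.

End Levels.

Section LevelBounds.
Context (R : realType) d (T : measurableType d) (P : probability T R).
Variables (N : T -> set (R * R)) (r : int -> {RV P >-> (R * R)%type}).
Hypothesis pp : poisson_process P N.
Hypothesis lab : {ae P, forall w, records_labelling (N w) (fun k => r k w)}.

Definition level w0 (w : T) l := levels w0 (fun k => r k%:Z w) l.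

Lemma measurable_level d' (T' : measurableType d') (w0 : T' -> R) (f : T' -> T) l :
  measurable_fun setT w0 -> measurable_fun setT f ->
  measurable_fun setT (fun t => level (w0 t) (f t) l).
Proof.
move=> mw0 mf; apply: measurable_levels => // k.
  by apply: (measurableT_comp measurable_fst); exact: measurableT_comp.
by apply: (measurableT_comp measurable_snd); exact: measurableT_comp.
Qed.

Variables (n : nat) (b : nat -> R * R).
Hypothesis b_sep : forall k, (k < n)%N ->
  [/\ 0 <= (b k.*2).1, 0 < (b k.*2.+1).1, (b k.*2).2 <= (b k.*2.+1).1 &
      0 <= (b k.*2.+2).1 /\ (b k.*2.+2).2 <= (b k.*2.+1).1].
Hypothesis b_le : forall l, (l <= n.*2)%N -> (b l).1 <= (b l).2.

Let len l := (b l).2 - (b l).1.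

Definition level_event w0 k :=
  [set w | forall l, (l < k.*2)%N -> (b l.+1).1 < level w0 w l.+1 <= (b l.+1).2].

Lemma measurable_level_event w0 k : measurable (level_event w0 k).
Proof.
rewrite (_ : level_event w0 k = \bigcap_(l in `I_(k.*2))
    (fun w => level w0 w l.+1) @^-1` `](b l.+1).1, (b l.+1).2]).
  apply: fin_bigcap_measurable; first exact: finite_II.
  move=> l _; rewrite -[X in measurable X]setTI.
  exact: (@measurable_level _ _ (fun=> w0) id).
by apply/seteqP; split => w H l /= lk; have := H l lk; rewrite /= in_itv.
Qed.

(** Each pair of levels is integrated out, given the previous level, by
    [freezing]; independence comes from the Markov property of the records. *)
Lemma level_event_bounds w0 k : (k <= n)%N -> (b 0%N).1 < w0 <= (b 0%N).2 ->
  ((\prod_(l < k.*2) len l.+1 *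
     \prod_(j < k) (expR (- ((b j.*2.+1).2 - (b j.*2).1)) / (b j.*2.+1).2))%:E <=
   P (level_event w0 k) <=
   (\prod_(l < k.*2) len l.+1 *
     \prod_(j < k) (expR (- ((b j.*2.+1).1 - (b j.*2).2)) / (b j.*2.+1).1))%:E)%E.
Proof.
move=> + bw0; elim: k => [_|k IH kn].
  have -> : level_event w0 0 = setT by apply/seteqP; split.
  by rewrite !big_ord0 mulr1 probability_setT lexx.
have {IH}/andP[IHl IHh] := IH (ltnW kn).
pose A := level_event w0 k; pose W w := level w0 w k.*2.
pose xi w := record_increment (r k.+1%:Z w) (r k.+2%:Z w).
pose D : set (R * (R * R)) := [set p |
  (b k.*2.+1).1 < p.1 + p.2.1 <= (b k.*2.+1).2 /\
  (b k.*2.+2).1 < p.2.2 * (p.1 + p.2.1) <= (b k.*2.+2).2].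
have eventS : level_event w0 k.+1 = A `&` [set w | D (W w, xi w)].
  apply/seteqP; split => w.
    move=> H; split => [l lk|]; first by apply: H; rewrite doubleS; lia.
    have H1 := H k.*2 ltac:(rewrite doubleS; lia).
    have H2 := H k.*2.+1 ltac:(rewrite doubleS; lia).
    split; move: H1 H2; rewrite /level levels_even levels_odd// => H1 H2.
  move=> [Aw [D1 D2]] l; rewrite doubleS ltnS leq_eqVlt => /predU1P[->|].
    by rewrite /level levels_even levels_odd; exact: D2.
  rewrite ltnS leq_eqVlt => /predU1P[->|]; last exact: Aw.
  by rewrite /level levels_odd; exact: D1.
pose B : set R := `](b k.*2).1, (b k.*2).2]%classic.
have mA : measurable A by exact: measurable_level_event.
have mW : measurable_fun setT W by exact: (@measurable_level _ _ (fun=> w0) id).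
have mr1 j : measurable_fun setT (fun w => (r j w).1).
  exact: (measurableT_comp measurable_fst).
have mr2 j : measurable_fun setT (fun w => (r j w).2).
  exact: (measurableT_comp measurable_snd).
have mxi : measurable_fun setT xi.
  apply: measurable_fun_pair.
    by apply: measurable_funM => //; exact: measurable_funB.
  by apply: measurable_funM => //; exact: measurable_funV.
have ind C G : measurable C -> measurable G ->
    (P (A `&` W @^-1` C `&` xi @^-1` G) = P (A `&` W @^-1` C) * driver R G)%E.
  move=> mC mG; pose I := (bool * 'I_k.+3)%type.
  pose Lv (v : coord_space R I) l := levels w0 (point_of v) l.
  have mLv l : measurable_fun setT (Lv ^~ l).
    by apply: measurable_levels => // j; exact: measurable_coord.
  (* The event A with W in C, read off the records up to index k.+1. *)
  pose S : set (coord_space R I) := (\bigcap_(l in `I_(k.*2))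
    Lv ^~ l.+1 @^-1` `](b l.+1).1, (b l.+1).2]%classic) `&` Lv ^~ k.*2 @^-1` C.
  have mS : measurable S.
    apply: measurableI; last by rewrite -[X in measurable X]setTI; exact: mLv.
    apply: fin_bigcap_measurable; first exact: finite_II.
    by move=> l _; rewrite -[X in measurable X]setTI; exact: mLv.
  have LvE w l : (l <= k.*2)%N -> Lv (flatten_points (fun j => r j%:Z w)) l = level w0 w l.
    by move=> lk; apply: (eq_levels _ lk) => j jk; rewrite flatten_pointsK//; lia.
  have <- : [set w | S (flatten_points (fun j => r j%:Z w))] = A `&` W @^-1` C.
    apply/seteqP; split => w.
      move=> [H1]; rewrite /= LvE// => H2; split => // l lk.
      by have := H1 l lk; rewrite /= in_itv/= LvE.
    move=> [H1 H2]; split; last by rewrite /= LvE.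
    by move=> l lk; rewrite /= in_itv/= LvE//; exact: H1.
  apply: (increment_independent pp lab) => // v v' vv'.
  have LvE' l : (l <= k.*2)%N -> Lv v l = Lv v' l.
    move=> lk; apply: (eq_levels _ lk) => j jk.
    by rewrite /point_of !vv'//= inordK//; lia.
  move=> [H1]; rewrite /= LvE'// => H2; split => // l lk.
  by have := H1 l lk; rewrite /= LvE'.
have mD : measurable D.
  pose f (p : R * (R * R)) := p.1 + p.2.1; pose g (p : R * (R * R)) := p.2.2 * (p.1 + p.2.1).
  have m21 : measurable_fun setT (fun p : R * (R * R) => p.2.1).
    exact: (measurableT_comp measurable_fst measurable_snd).
  have m22 : measurable_fun setT (fun p : R * (R * R) => p.2.2).
    exact: (measurableT_comp measurable_snd measurable_snd).
  have mf : measurable_fun setT f by exact: measurable_funD.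
  have mg : measurable_fun setT g by exact: measurable_funM.
  rewrite (_ : D = f @^-1` `](b k.*2.+1).1, (b k.*2.+1).2] `&`
                   g @^-1` `](b k.*2.+2).1, (b k.*2.+2).2]).
    by apply: measurableI; rewrite -[X in measurable X]setTI; [exact: mf|exact: mg].
  by apply/seteqP; split => p; rewrite /= !in_itv.
have AB : A `<=` W @^-1` B.
  move=> w Aw; rewrite /B /= in_itv/= /W.
  case: k {IHl IHh kn eventS mA mW mxi ind mD D xi W B} @A Aw => [//|k] A Aw.
  by have := Aw k.*2.+1; rewrite doubleS; apply.
have [bk0 bk1 bk2 [bk3 bk4]] := b_sep kn.
have l1 : (b k.*2.+1).1 <= (b k.*2.+1).2 by apply: b_le; clear -kn; lia.
have l2 : (b k.*2.+2).1 <= (b k.*2.+2).2 by apply: b_le; clear -kn; lia.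
have bk1' : 0 < (b k.*2.+1).2 by exact: lt_le_trans l1.
have len12 : 0 <= len k.*2.+1 * len k.*2.+2 by rewrite mulr_ge0// subr_ge0.
pose lo := len k.*2.+1 * len k.*2.+2 * (expR (- ((b k.*2.+1).2 - (b k.*2).1)) / (b k.*2.+1).2).
pose hi := len k.*2.+1 * len k.*2.+2 * (expR (- ((b k.*2.+1).1 - (b k.*2).2)) / (b k.*2.+1).1).
have lo0 : 0 <= lo by rewrite mulr_ge0// divr_ge0 ?expR_ge0// ltW.
have hi0 : 0 <= hi by rewrite mulr_ge0// divr_ge0 ?expR_ge0// ltW.
have loBhi x : B x -> (lo%:E <= driver R (xsection D x) <= hi%:E)%E.
  rewrite /B /= in_itv/= => /andP[bx xb].
  rewrite (_ : xsection D x = [set p | (b k.*2.+1).1 < x + p.1 <= (b k.*2.+1).2 /\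
      (b k.*2.+2).1 < p.2 * (x + p.1) <= (b k.*2.+2).2]); last first.
    by apply/seteqP; split => p; rewrite /xsection/= inE.
  have /andP[k1 k2] := @driver_next_level _ x (b k.*2.+1).1 (b k.*2.+1).2
     (b k.*2.+2).1 (b k.*2.+2).2 ltac:(lra) ltac:(lra) bk1 l1 bk3 l2 bk4.
  apply/andP; split; [apply: le_trans k1|apply: (le_trans k2)];
    rewrite lee_fin ler_wpM2l// ler_wpM2r ?invr_ge0 ?(ltW bk1) ?(ltW bk1')// ler_expR; lra.
have /andP[fl fh] := freezing mA mW mxi ind mD (measurable_itv _) AB lo0 loBhi.
rewrite eventS doubleS !big_ord_recr/=.
apply/andP; split; [apply: le_trans fl|apply: (le_trans fh)].
  rewrite [leLHS](_ : _ = (lo%:E * (\prod_(l < k.*2) len l.+1 *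
     \prod_(j < k) (expR (- ((b j.*2.+1).2 - (b j.*2).1)) / (b j.*2.+1).2))%:E)%E).
    by rewrite lee_wpmul2l.
  by rewrite -EFinM /lo; congr EFin; ring.
rewrite [leRHS](_ : _ = (hi%:E * (\prod_(l < k.*2) len l.+1 *
     \prod_(j < k) (expR (- ((b j.*2.+1).1 - (b j.*2).2)) / (b j.*2.+1).1))%:E)%E).
  by rewrite lee_wpmul2l.
by rewrite -EFinM /hi; congr EFin; ring.
Qed.

End LevelBounds.

(** * Tiles as functions of the levels *)

Section TilesFromLevels.
Context (R : realType).
Implicit Types z : nat -> R.

(** The points (level_time z k, level_value z k) have the same tile areas as the
    records behind the levels z, scaled by (t, x) -> (c t, x / c) so that the first
    value is 1. *)
Fixpoint level_value z (k : nat) : R :=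
  if k is k'.+1 then level_value z k' * (z k'.*2.+2 / z k'.*2.+1) else 1.

Definition level_time z (k : nat) : R := z k.*2 / level_value z k.

Definition level_tile z (i j : nat) : R :=
  (level_value z i - level_value z i.+1) * (level_time z j.+1 - level_time z j).

Lemma level_valueS z k :
  level_value z k.+1 = level_value z k * (z k.*2.+2 / z k.*2.+1).
Proof. by []. Qed.

Lemma level_value_gt0 z n : (forall l, (l <= n.*2)%N -> 0 < z l) ->
  forall k, (k <= n)%N -> 0 < level_value z k.
Proof.
move=> z0; elim=> //= k IH kn; rewrite mulr_gt0// ?IH// 1?ltnW//.
by rewrite divr_gt0// z0//; lia.
Qed.

Lemma level_timeS z n k : (forall l, (l <= n.*2)%N -> 0 < z l) -> (k < n)%N ->
  level_time z k.+1 = z k.*2.+1 / level_value z k.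
Proof.
move=> z0 kn; rewrite /level_time /= doubleS.
have v0 := level_value_gt0 z0 (ltnW kn).
have z1 : 0 < z k.*2.+1 by apply: z0; lia.
have z2 : 0 < z k.*2.+2 by apply: z0; lia.
by field; rewrite !gt_eqF.
Qed.

Section Reversal.
Variables (n : nat) (z : nat -> R).
Hypothesis z0 : forall l, (l <= n.*2)%N -> 0 < z l.
Let zr l := z (n.*2 - l)%N.

(** Reading the levels backwards exchanges times and values of the recovered
    records and reverses their order, up to a scaling that tile areas do not
    see. *)
Lemma level_value_rev k : (k <= n)%N ->
  level_value zr k = level_time z (n - k) / level_time z n.
Proof.
have tn : 0 < level_time z n.
  by rewrite divr_gt0 ?z0// (level_value_gt0 z0).
elim: k => [_|k IH kn]; first by rewrite subn0 divff// gt_eqF.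
rewrite /= IH ?(ltnW kn)//.
pose m := (n - k.+1)%N; have mn : (m < n)%N by rewrite /m; lia.
have -> : (n - k = m.+1)%N by rewrite /m; lia.
rewrite (level_timeS z0 mn) /zr.
have -> : (n.*2 - k.*2.+2 = m.*2)%N by rewrite /m; lia.
have -> : (n.*2 - k.*2.+1 = m.*2.+1)%N by rewrite /m; lia.
rewrite -/m {2}/level_time.
have v0 := level_value_gt0 z0 (ltnW mn).
have z1 : 0 < z m.*2.+1 by apply: z0; lia.
by field; rewrite !gt_eqF.
Qed.

Lemma level_time_rev k : (k <= n)%N ->
  level_time zr k = level_value z (n - k) * level_time z n.
Proof.
move=> kn; rewrite {1}/level_time level_value_rev// /zr.
have tn : 0 < level_time z n.
  by rewrite divr_gt0 ?z0// (level_value_gt0 z0).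
have -> : (n.*2 - k.*2 = (n - k).*2)%N by lia.
have zk : 0 < z (n - k).*2 by apply: z0; lia.
have v0 := @level_value_gt0 z n z0 (n - k)%N (leq_subr _ _).
by rewrite {1}/level_time; field; rewrite !gt_eqF.
Qed.

Lemma level_tile_rev i j : (i < n)%N -> (j < n)%N ->
  level_tile zr i j = level_tile z (n - j.+1) (n - i.+1).
Proof.
move=> im jn; rewrite /level_tile !level_value_rev ?(ltnW im)//.
rewrite !level_time_rev ?(ltnW jn)//.
have -> : ((n - i.+1).+1 = n - i)%N by lia.
have -> : ((n - j.+1).+1 = n - j)%N by lia.
have tn : 0 < level_time z n.
  by rewrite divr_gt0 ?z0// (level_value_gt0 z0).
by field; rewrite gt_eqF.
Qed.

End Reversal.

(** Changing the initial level w0 only translates the recovered times, so tile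
    areas do not depend on it. *)
Lemma level_tile_levels (n : nat) (w0 : R) (p : nat -> R * R) i j : 0 < w0 ->
  (forall k, (k <= n.+1)%N -> 0 < (p k).2) ->
  (forall k, (k <= n)%N -> (p k).1 < (p k.+1).1) ->
  (i < n)%N -> (j < n)%N ->
  level_tile (levels w0 p) i j =
  ((p i.+1).2 - (p i.+2).2) * ((p j.+2).1 - (p j.+1).1).
Proof.
move=> w00 p2 p1 im jn.
have z0 := levels_pos w00 p2 p1.
have vE k : (k <= n)%N -> level_value (levels w0 p) k = (p k.+1).2 / (p 1%N).2.
  elim: k => [_|k IH kn]; first by rewrite divff// gt_eqF// p2.
  rewrite level_valueS IH 1?ltnW// levels_even /record_increment.
  have l1 : 0 < levels w0 p k.*2.+1 by apply: z0; lia.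
  have pk : 0 < (p k.+1).2 by apply: p2; lia.
  have p1' : 0 < (p 1%N).2 by apply: p2.
  move: l1; set l := levels w0 p _ => l1 /=.
  by field; rewrite !gt_eqF.
rewrite /level_tile !vE ?(ltnW im)// (level_timeS z0 jn) /level_time vE 1?ltnW//.
rewrite levels_odd /record_increment; set l := levels w0 p _ => /=.
have pj : 0 < (p j.+1).2 by apply: p2; lia.
have p1' : 0 < (p 1%N).2 by apply: p2.
by field; rewrite !gt_eqF.
Qed.

Lemma measurable_level_tile d (T : measurableType d) (z : T -> nat -> R) i j :
  (forall l, measurable_fun setT (fun t => z t l)) ->
  measurable_fun setT (fun t => level_tile (z t) i j).
Proof.
move=> mz.
have mv k : measurable_fun setT (fun t => level_value (z t) k).
  elim: k => //= k IH; apply: measurable_funM => //; apply: measurable_funM => //.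
  exact: measurable_funV.
have mt k : measurable_fun setT (fun t => level_time (z t) k).
  by apply: measurable_funM => //; exact: measurable_funV.
by apply: measurable_funM; exact: measurable_funB.
Qed.

End TilesFromLevels.

Lemma measurable_matrix_event (R : realType) d (T : measurableType d) m n
    (X : T -> 'M[R]_(m, n)) (E : set 'M[R]_(m, n)) :
  (forall i j, measurable_fun setT (fun t => X t i j)) ->
  @measurable_mx R m n E -> measurable (X @^-1` E).
Proof.
move=> mX; rewrite -[X @^-1` E]setTI.
have sig := @sigma_algebra_image _ _ _ X _ (@sigma_algebra_measurable _ T).
apply: (smallest_sub sig) => _ [i [j [B mB ->]]].
exact: mX.
Qed.

(** * Symmetry of the density of the levels *)

Lemma sum_alternate (R : pzRingType) (F : nat -> R) n :
  \sum_(l < n.*2.+1) F l =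
  \sum_(j < n.+1) F j.*2 + \sum_(j < n) F j.*2.+1.
Proof.
elim: n => [|n IH]; first by rewrite !big_ord_recr !big_ord0/= addr0.
rewrite doubleS 2!big_ord_recr IH [in RHS]big_ord_recr/=.
rewrite [\sum_(j < n.+1) F j.*2.+1]big_ord_recr/= -!addrA; congr (_ + _).
by rewrite addrA addrC.
Qed.

Section LevelDensity.
Context (R : realType).
Implicit Types b : nat -> R * R.
Variable n : nat.

Definition girth b : R := \sum_(l < n.*2.+1) ((b l).2 - (b l).1).

Definition box_volume b : R := \prod_(l < n.*2.+1) ((b l).2 - (b l).1).

(** Lower and upper bounds on a box for the density of the levels
    w_1, v_1, ..., v_n, w_(n+1) started from a unit exponential w_1, which is
    exp (- w_1 - sum (v_j - w_j)) / prod v_j. *)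
Definition level_density_lower b : R :=
  expR (- (b 0%N).2) *
  \prod_(j < n) (expR (- ((b j.*2.+1).2 - (b j.*2).1)) / (b j.*2.+1).2).

Definition level_density_upper b : R :=
  expR (- (b 0%N).1) *
  \prod_(j < n) (expR (- ((b j.*2.+1).1 - (b j.*2).2)) / (b j.*2.+1).1).

Lemma box_volume_rev b : box_volume (fun l => b (n.*2 - l)%N) = box_volume b.
Proof.
rewrite /box_volume (reindex_inj rev_ord_inj)/=; apply: eq_bigr => l _.
by rewrite subSS subKn// -ltnS.
Qed.

(** The exponent - w_1 - sum (v_j - w_j) equals w_2 + ... + w_n - sum v_j, hence the
    density is the same when the levels are read backwards. *)
Lemma level_density_rev b (K : R) : 0 <= K ->
  (forall l, (l <= n.*2)%N -> (b l).1 <= (b l).2) ->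
  (forall j, (j < n)%N -> 0 < (b j.*2.+1).1 /\ (b j.*2.+1).1^-1 <= K) ->
  level_density_upper b <=
  expR ((1 + K) * girth b) *
    level_density_lower (fun l => b (n.*2 - l)%N).
Proof.
move=> K0 ble bK.
pose len l := (b l).2 - (b l).1.
have len0 l : (l <= n.*2)%N -> 0 <= len l by move=> /ble; rewrite subr_ge0.
have girthE : girth b = \sum_(j < n.+1) len j.*2 + \sum_(j < n) len j.*2.+1.
  exact: sum_alternate.
rewrite /level_density_upper /level_density_lower !big_split/= -!expR_sum !sumrN subn0.
have -> : \sum_(j < n) ((b (n.*2 - j.*2.+1)%N).2 - (b (n.*2 - j.*2)%N).1) =
    \sum_(j < n) (b j.*2.+1).2 - \sum_(j < n) (b j.+1.*2).1.
  rewrite sumrB; congr (_ - _); rewrite (reindex_inj rev_ord_inj)/=;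
    apply: eq_bigr => j _; congr (_ _).
    by congr b; have := ltn_ord j; lia.
  by congr b; have := ltn_ord j; lia.
have -> : \prod_(j < n) (b (n.*2 - j.*2.+1)%N).2^-1 = \prod_(j < n) (b j.*2.+1).2^-1.
  rewrite (reindex_inj rev_ord_inj)/=; apply: eq_bigr => j _; congr (_ ^-1).
  by congr (b _).2; have := ltn_ord j; lia.
have odd0 : 0 <= \sum_(j < n) len j.*2.+1.
  by apply: sumr_ge0 => j _; apply: len0; have := ltn_ord j; lia.
have even0 : 0 <= \sum_(j < n.+1) len j.*2.
  by apply: sumr_ge0 => j _; apply: len0; have := ltn_ord j; lia.
(* On an odd side [p, q] the quotient q / p is at most 1 + K (q - p). *)
have quot : \prod_(j < n) (b j.*2.+1).1^-1 <=
    expR (K * girth b) * \prod_(j < n) (b j.*2.+1).2^-1.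
  apply: (@le_trans _ _ (expR (\sum_(j < n) K * len j.*2.+1) * \prod_(j < n) (b j.*2.+1).2^-1)).
    rewrite expR_sum -big_split/=; apply: ler_prod => j _.
    have [b1 bK1] := bK j (ltn_ord j).
    have b12 : (b j.*2.+1).1 <= (b j.*2.+1).2 by apply: ble; have := ltn_ord j; lia.
    have b2 : 0 < (b j.*2.+1).2 by exact: lt_le_trans b12.
    rewrite invr_ge0 (ltW b1)/= ler_pdivlMr//.
    apply: (@le_trans _ _ (1 + K * len j.*2.+1)); last exact: expR_ge1Dx.
    have -> : (b j.*2.+1).1^-1 * (b j.*2.+1).2 = 1 + (b j.*2.+1).1^-1 * len j.*2.+1.
      by rewrite /len; field; rewrite gt_eqF.
    by rewrite lerD2l ler_wpM2r// len0//; have := ltn_ord j; lia.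
  rewrite ler_wpM2r//.
    by apply: prodr_ge0 => j _; rewrite invr_ge0; have [b1 _] := bK j (ltn_ord j);
      rewrite (le_trans (ltW b1))//; apply: ble; have := ltn_ord j; lia.
  by rewrite ler_expR -mulr_sumr ler_wpM2l// girthE lerDr.
rewrite mulrDl mul1r expRD [leLHS]mulrA.
apply: (le_trans (ler_wpM2l _ quot)); first by rewrite mulr_ge0 ?expR_ge0.
rewrite le_eqVlt; apply/orP; left; apply/eqP.
rewrite !mulrA; congr (_ * _).
rewrite [LHS]mulrC !mulrA [expR (girth b) * _]mulrC -!mulrA; congr (_ * _).
rewrite -!expRD; congr expR; rewrite girthE /len.
rewrite !sumrB [\sum_(j < n.+1) (b j.*2).2]big_ord_recr [\sum_(j < n.+1) (b j.*2).1]big_ord_recl/=.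
have -> : \sum_(j < n) (b (bump 0 j).*2).1 = \sum_(j < n) (b j.+1.*2).1 by [].
by ring.
Qed.

End LevelDensity.

(** * Reversibility *)

Section Reversibility.
Context (R : realType) d (T : measurableType d) (P : probability T R).
Variables (N : T -> set (R * R)) (r : int -> {RV P >-> (R * R)%type}).
Hypothesis pp : poisson_process P N.
Hypothesis lab : {ae P, forall w, records_labelling (N w) (fun k => r k w)}.
Variable n : nat.
Local Notation I := ('I_(n.*2.+1)).

(** The initial level is an independent unit exponential variable. This is the
    stationary law of the chain W -> U (W + E), for which the levels are
    reversible. *)
Definition extended_law : probability (R * T)%type R :=
  product_probability (unit_exponential R) P.

Definition alternating_order : rel I := fun i j =>
  [&& ~~ odd i, odd j & (i == j.+1 :> nat) || (j == i.+1 :> nat)].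

Definition alternating_box (b : nat -> R * R) :=
  (forall k, (k < n)%N ->
    [/\ 0 <= (b k.*2).1, 0 < (b k.*2.+1).1, (b k.*2).2 <= (b k.*2.+1).1 &
      0 <= (b k.*2.+2).1 /\ (b k.*2.+2).2 <= (b k.*2.+1).1]) /\
  (forall l, (l <= n.*2)%N -> 0 <= (b l).1 <= (b l).2).

Definition in_box (b : nat -> R * R) : set (R * T) :=
  [set p | forall l, (l <= n.*2)%N -> (b l).1 < level r p.1 p.2 l <= (b l).2].

Definition rev_box (b : nat -> R * R) (l : nat) := b (n.*2 - l)%N.

Lemma alternating_box_rev b : alternating_box b -> alternating_box (rev_box b).
Proof.
move=> [b1 b2]; split=> [k kn|l ln]; rewrite /rev_box; last by apply: b2; lia.
pose j := (n - k.+1)%N; have jn : (j < n)%N by rewrite /j; lia.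
have -> : (n.*2 - k.*2 = j.*2.+2)%N by rewrite /j; lia.
have -> : (n.*2 - k.*2.+1 = j.*2.+1)%N by rewrite /j; lia.
have -> : (n.*2 - k.*2.+2 = j.*2)%N by rewrite /j; lia.
by have [? ? ? [? ?]] := b1 j jn.
Qed.

Lemma measurable_in_box b : measurable (in_box b).
Proof.
rewrite (_ : in_box b = \bigcap_(l in `I_n.*2.+1)
    (fun p : R * T => level r p.1 p.2 l) @^-1` `](b l).1, (b l).2]).
  apply: fin_bigcap_measurable; first exact: finite_II.
  move=> l _; rewrite -[X in measurable X]setTI.
  exact: (measurable_level _ _ measurable_fst measurable_snd).
by apply/seteqP; split => p H l /= ln; have := H l ln; rewrite /= in_itv.
Qed.

Lemma in_box_bounds b : alternating_box b ->
  ((box_volume n b * level_density_lower n b)%:E <= extended_law (in_box b)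
   <= (box_volume n b * level_density_upper n b)%:E)%E.
Proof.
move=> [b1 b2]; pose len l := (b l).2 - (b l).1.
have ble l : (l <= n.*2)%N -> (b l).1 <= (b l).2 by move=> /b2 /andP[].
have len0 l : (l <= n.*2)%N -> 0 <= len l by move=> /ble; rewrite subr_ge0.
pose V := \prod_(l < n.*2) len l.+1.
have V0 : 0 <= V by apply: prodr_ge0 => l _; apply: len0; have := ltn_ord l; lia.
have volE : box_volume n b = len 0%N * V by rewrite /box_volume big_ord_recl.
pose lo := V * \prod_(j < n) (expR (- ((b j.*2.+1).2 - (b j.*2).1)) / (b j.*2.+1).2).
pose hi := V * \prod_(j < n) (expR (- ((b j.*2.+1).1 - (b j.*2).2)) / (b j.*2.+1).1).
have lo0 : 0 <= lo.
  rewrite mulr_ge0//; apply: prodr_ge0 => j _; rewrite divr_ge0 ?expR_ge0//.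
  have [_ bj _ _] := b1 j (ltn_ord j); rewrite (le_trans (ltW bj))//.
  by apply: ble; have := ltn_ord j; lia.
have hi0 : 0 <= hi.
  rewrite mulr_ge0//; apply: prodr_ge0 => j _; rewrite divr_ge0 ?expR_ge0//.
  by have [_ bj _ _] := b1 j (ltn_ord j); exact: ltW.
pose A : set R := `](b 0%N).1, (b 0%N).2]%classic.
(* The initial level is the first coordinate; it ranges over side 0 of the box. *)
have secA w0 : A w0 -> (lo%:E <= P (xsection (in_box b) w0) <= hi%:E)%E.
  rewrite /A /= in_itv/= => bw0.
  rewrite (_ : xsection _ w0 = level_event r b w0 n).
    exact: (level_event_bounds pp lab b1 ble).
  apply/seteqP; split => w; rewrite /xsection/= inE => H l ln; first exact: H.
  by case: l ln => [//|l ln]; exact: H.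
have secN w0 : ~ A w0 -> xsection (in_box b) w0 = set0.
  move=> nA; apply/seteqP; split => // w; rewrite /xsection/= inE => /(_ 0%N isT) H.
  by apply: nA; rewrite /A /= in_itv.
have /andP[fl fh] : (lo%:E * unit_exponential R A <= extended_law (in_box b)
    <= hi%:E * unit_exponential R A)%E.
  by apply: product_probability_bounds => //; [exact: measurable_itv|exact: measurable_in_box].
have /andP[el eh] := unit_exponential_bounds (b2 0%N isT).
apply/andP; split; [apply: le_trans fl|apply: (le_trans fh)].
- rewrite [leLHS](_ : _ = lo%:E * (((b 0%N).2 - (b 0%N).1) * expR (- (b 0%N).2))%:E)%E.
    by rewrite lee_wpmul2l.
  by rewrite -EFinM volE /lo /level_density_lower /len; congr EFin; ring.
- rewrite [leRHS](_ : _ = hi%:E * (((b 0%N).2 - (b 0%N).1) * expR (- (b 0%N).1))%:E)%E.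
    by rewrite lee_wpmul2l.
  by rewrite -EFinM volE /hi /level_density_upper /len; congr EFin; ring.
Qed.

Lemma in_box_rev_le b (K : R) : 0 <= K -> alternating_box b ->
  (forall j, (j < n)%N -> (b j.*2.+1).1^-1 <= K) ->
  (extended_law (in_box b) <=
   (expR ((1 + K) * girth n b))%:E * extended_law (in_box (rev_box b)))%E.
Proof.
move=> K0 altb bK; have [b1 b2] := altb.
have /andP[_ bh] := in_box_bounds altb.
have /andP[bl _] := in_box_bounds (alternating_box_rev altb).
apply: (le_trans bh); apply: le_trans (lee_wpmul2l _ bl); last by rewrite lee_fin expR_ge0.
rewrite -EFinM lee_fin box_volume_rev [leRHS]mulrCA ler_wpM2l//.
  apply: prodr_ge0 => l _; rewrite subr_ge0.
  by have /andP[] := b2 l (leq_ord l).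
apply: level_density_rev => // [l ln|j jn]; first by have /andP[] := b2 l ln.
by have [_ ? _ _] := b1 j jn; split => //; exact: bK.
Qed.

Let Z (p : R * T) : I -> R := fun l => level r p.1 p.2 l.
Let Zr (p : R * T) : I -> R := fun l => level r p.1 p.2 (n.*2 - l).

Let mZ l : measurable_fun setT (fun p => Z p l).
Proof. exact: (measurable_level _ _ measurable_fst measurable_snd). Qed.

Let mZr l : measurable_fun setT (fun p => Zr p l).
Proof. exact: (measurable_level _ _ measurable_fst measurable_snd). Qed.

Lemma levels_proper : {ae extended_law, forall p,
  0 < p.1 /\ proper_records (fun k => r k p.2)}.
Proof. exact: (ae_product (@unit_exponential_ae R) (records_proper pp lab)). Qed.

Lemma alternating_levels p : 0 < p.1 -> proper_records (fun k => r k p.2) ->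
  (forall l, (l <= n.*2)%N -> 0 < level r p.1 p.2 l) /\
  forall k, (k < n)%N ->
    level r p.1 p.2 k.*2 < level r p.1 p.2 k.*2.+1 /\
    level r p.1 p.2 k.*2.+2 < level r p.1 p.2 k.*2.+1.
Proof.
move=> p0 [pos dec _ _].
have dec' (k : nat) : (r k%:Z p.2).1 < (r k.+1%:Z p.2).1 /\ (r k.+1%:Z p.2).2 < (r k%:Z p.2).2.
  have kS : k.+1%:Z = k%:Z + 1 by rewrite intS addrC.
  by rewrite kS; exact: dec.
have lpos : forall l, (l <= n.*2)%N -> 0 < level r p.1 p.2 l.
  apply: levels_pos => // k _; first by have [] := pos k.
  by have [] := dec' k.
split => // k kn; have [x0 _] := pos k.+1; have [? ?] := dec' k.+1.
split; first by apply: levels_increase => //; have [] := pos k.+1.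
apply: levels_decrease => //; first by have [] := pos k.+1.
by apply: lpos; lia.
Qed.

Let chainZ : {ae extended_law, forall p, chain alternating_order (Z p)}.
Proof.
apply: filterS levels_proper => p [p0 prop].
have [pos alt] := alternating_levels p0 prop.
split=> [l|i j /and3P[ei oj ij]]; first by apply: pos; rewrite -ltnS.
have [k jE] : exists k, j = k.*2.+1 :> nat.
  by exists j./2; rewrite -[LHS]odd_double_half oj.
have kn : (k < n)%N by have := ltn_ord j; lia.
have [h1 h2] := alt _ kn.
rewrite /Z jE; case/orP: ij => /eqP ij; first by rewrite ij jE.
by have -> : i = k.*2 :> nat by lia.
Qed.

Let chainZr : {ae extended_law, forall p, chain alternating_order (Zr p)}.
Proof.
apply: filterS levels_proper => p [p0 prop].
have [pos alt] := alternating_levels p0 prop.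
split=> [l|i j /and3P[ei oj ij]]; first by apply: pos; lia.
have [k jE] : exists k, j = k.*2.+1 :> nat.
  by exists j./2; rewrite -[LHS]odd_double_half oj.
have kn : (k < n)%N by have := ltn_ord j; lia.
have [h1 h2] := alt (n - k.+1)%N ltac:(lia).
rewrite /Zr; have -> : (n.*2 - j = (n - k.+1).*2.+1)%N by lia.
case/orP: ij => /eqP ij.
  by have -> : (n.*2 - i = (n - k.+1).*2)%N by lia.
by have -> : (n.*2 - i = (n - k.+1).*2.+2)%N by lia.
Qed.

Let ext (b : I -> R * R) l : R * R := b (inord l).

Let Z_box b : Z @^-1` box b = in_box (ext b).
Proof.
apply/seteqP; split => p H l.
  by move=> ln; have := H (inord l); rewrite /Z inordK.
by have := H l (leq_ord l); rewrite /ext inord_val.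
Qed.

Let Zr_box b : Zr @^-1` box b = in_box (rev_box (ext b)).
Proof.
apply/seteqP; split => p H l.
  move=> ln; have := H (inord (n.*2 - l)); rewrite /Zr inordK ?ltnS ?leq_subr//.
  by rewrite subKn.
have := H (n.*2 - l)%N (leq_subr _ _).
by rewrite /rev_box /ext subKn ?leq_ord// inord_val.
Qed.

Let in_box_rev_rev b : in_box (rev_box (rev_box b)) = in_box b.
Proof.
by apply/seteqP; split => p H l ln; have := H l ln; rewrite /rev_box subKn.
Qed.

Let girth_rev b : girth n (rev_box b) = girth n b.
Proof.
rewrite /girth (reindex_inj rev_ord_inj)/=; apply: eq_bigr => l _.
by rewrite /rev_box subSS subKn// -ltnS.
Qed.

Let girthE b : girth n (ext b) = box_girth b.
Proof. by apply: eq_bigr => l _; rewrite /ext inord_val. Qed.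

Let sub_alternating (Q b : I -> R * R) : separated alternating_order Q -> sub_box b Q ->
  alternating_box (ext b) /\
  forall j, (j < n)%N -> (ext b j.*2.+1).1^-1 <= \sum_i `|(Q i).1^-1|.
Proof.
move=> [Q0 Qe] bQ.
have Qs i j : (i <= n.*2)%N -> (j <= n.*2)%N -> ~~ odd i -> odd j ->
    (i == j.+1) || (j == i.+1) -> (b (inord i)).2 <= (b (inord j)).1 /\
    0 < (Q (inord j)).1.
  move=> im jm ei oj ij.
  have /Qe Qij : alternating_order (inord i) (inord j) by rewrite /alternating_order !inordK// ei oj.
  have [? ? ?] := bQ (inord i); have [? ? ?] := bQ (inord j).
  by have /andP[? ?] := Q0 (inord i); split; lra.
have b0 i : 0 <= (b i).1 by have [? _ _] := bQ i; have /andP[? _] := Q0 i; lra.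
have odd_pos j : (j < n)%N -> 0 < (Q (inord j.*2.+1)).1.
  by move=> jn; apply: (proj2 (Qs j.*2 _ _ _ _ _ _)); rewrite /= ?odd_double ?eqxx ?orbT//; lia.
split; first split=> [k kn|l ln]; rewrite /ext.
- have [h1 h2] : (b (inord k.*2)).2 <= (b (inord k.*2.+1)).1 /\ 0 < (Q (inord k.*2.+1)).1.
    by apply: Qs; rewrite /= ?odd_double ?eqxx ?orbT//; lia.
  have [h3 _] : (b (inord k.*2.+2)).2 <= (b (inord k.*2.+1)).1 /\ 0 < (Q (inord k.*2.+1)).1.
    by apply: Qs; rewrite /= ?odd_double ?eqxx ?orbT//; lia.
  have [? _ _] := bQ (inord k.*2.+1).
  by split => //; lra.
- by rewrite b0/=; have [] := bQ (inord l).
- move=> j jn; have Qj := odd_pos j jn; have [Qb _ _] := bQ (inord j.*2.+1).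
  rewrite /ext (bigD1 (inord j.*2.+1))//=.
  apply: (@le_trans _ _ `|(Q (inord j.*2.+1)).1^-1|); last by rewrite lerDl sumr_ge0.
  by rewrite ger0_norm ?invr_ge0 ?(ltW Qj)// lef_pV2// posrE (lt_le_trans Qj).
Qed.

(** Both sequences obey the estimates of the same density on separated boxes. *)
Theorem levels_reversible (S : set (coord_space R I)) : measurable S ->
  extended_law (Z @^-1` S) = extended_law (Zr @^-1` S).
Proof.
apply: (eq_law_of_box_dominated mZ mZr chainZ chainZr) => // Q sepQ;
  exists (1 + \sum_i `|(Q i).1^-1|) => b bQ; rewrite Z_box Zr_box -girthE;
  have [altb bK] := sub_alternating sepQ bQ.
  by apply: in_box_rev_le => //; exact: sumr_ge0.
rewrite -[in_box (ext b)]in_box_rev_rev -girth_rev; apply: in_box_rev_le; first exact: sumr_ge0.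
  exact: alternating_box_rev.
move=> j jn; rewrite /rev_box.
have -> : (n.*2 - j.*2.+1 = (n - j.+1).*2.+1)%N by lia.
by apply: bK; lia.
Qed.

(** The matrix is a function of the levels, and its reflection is the same function
    of the levels read backwards. *)
Theorem tile_matrix_reversible (E : set 'M[R]_n) : measurable_mx E ->
  P ((fun w => antitranspose (tile_matrix n (fun k => r k w))) @^-1` E) =
  P ((fun w => tile_matrix n (fun k => r k w)) @^-1` E).
Proof.
move=> mE.
pose tiles (z : nat -> R) : 'M[R]_n := \matrix_(i, j) level_tile z i j.
pose vec (v : coord_space R I) l := v (inord l).
pose S : set (coord_space R I) := (fun v => tiles (vec v)) @^-1` E.
have mS : measurable S.
  apply: measurable_matrix_event mE => i j.
  rewrite (_ : (fun _ => _) = fun v => level_tile (vec v) i j).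
    by apply: measurable_level_tile => l; exact: measurable_coord.
  by apply/funext => v; rewrite mxE.
have mr1 k : measurable_fun setT (fun w => (r k w).1).
  exact: (measurableT_comp measurable_fst).
have mr2 k : measurable_fun setT (fun w => (r k w).2).
  exact: (measurableT_comp measurable_snd).
have mtile i j : measurable_fun setT (fun w => tile_area (fun k => r k w) i j).
  by apply: measurable_funM; exact: measurable_funB.
pose F w := tile_matrix n (fun k => r k w).
have mF : measurable (F @^-1` E).
  apply: measurable_matrix_event mE => i j.
  by rewrite (_ : (fun _ => _) = (fun w => tile_area (fun k => r k w) i.+1%:Z j.+1%:Z))//;
    apply/funext => w; rewrite mxE.
have mF' : measurable ((fun w => antitranspose (F w)) @^-1` E).
  apply: measurable_matrix_event mE => i j.
  by rewrite (_ : (fun _ => _) = 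
      (fun w => tile_area (fun k => r k w) (rev_ord j).+1%:Z (rev_ord i).+1%:Z))//;
    apply/funext => w; rewrite !mxE.
have lift A : measurable A -> P A = extended_law (setT `*` A).
  by move=> mA; rewrite [RHS]product_probabilityX// probability_setT mul1e.
have mZT : measurable_fun setT (Z : R * T -> coord_space R I) by exact: measurable_vector.
have mZrT : measurable_fun setT (Zr : R * T -> coord_space R I) by exact: measurable_vector.
have tilesE p : 0 < p.1 -> proper_records (fun k => r k p.2) ->
    tiles (fun l => level r p.1 p.2 l) = F p.2.
  move=> p0 [pos dec _ _]; apply/matrixP => i j; rewrite !mxE /tile_area.
  have kS (k : nat) : k%:Z + 1 = k.+1%:Z by rewrite intS addrC.
  rewrite !kS; apply: (@level_tile_levels _ n) => // k _.
    by have [] := pos k.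
  by have [] := dec k; rewrite kS.
have eqtiles z z' : (forall l, (l <= n.*2)%N -> z l = z' l) -> tiles z = tiles z'.
  move=> zz'; apply/matrixP => i j; rewrite !mxE /level_tile.
  have vE k : (k <= n)%N -> level_value z k = level_value z' k.
    elim: k => // k IH kn; rewrite !level_valueS IH 1?ltnW//.
    by rewrite !zz'//; lia.
  have tE k : (k <= n)%N -> level_time z k = level_time z' k.
    by move=> kn; rewrite /level_time vE// zz'//; lia.
  by rewrite !vE ?tE// ltnW.
rewrite (lift _ mF) (lift _ mF').
transitivity (extended_law (Zr @^-1` S)).
  apply: eq_measure_ae; first exact: measurableX.
    by rewrite -[X in measurable X]setTI; exact: mZrT.
  apply: filterS levels_proper => p [p0 prop].
  have [pos _] := alternating_levels p0 prop.
  rewrite /S /= (eqtiles _ (fun l => level r p.1 p.2 (n.*2 - l))); last first.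
    by move=> l ln; rewrite /vec /Zr inordK.
  rewrite (_ : tiles _ = antitranspose (F p.2)); first by split => [[]|].
  rewrite -tilesE//; apply/matrixP => i j; rewrite !mxE.
  by rewrite (level_tile_rev pos).
rewrite -levels_reversible//.
apply: eq_measure_ae; last 2 first.
- exact: measurableX.
- apply: filterS levels_proper => p [p0 prop].
  rewrite /S /= (eqtiles _ (fun l => level r p.1 p.2 l)); last first.
    by move=> l ln; rewrite /vec /Z inordK.
  by rewrite tilesE//; split => [|[]].
- by rewrite -[X in measurable X]setTI; exact: mZT.
Qed.

End Reversibility.

Theorem proposition1 (R : realType) (d : measure_display) (T : measurableType d)
    (P : probability T R) (N : T -> set (R * R)) (r : int -> {RV P >-> (R * R)%type})
    (n : nat) :
  poisson_process P N ->
  {ae P, forall w, records_labelling (N w) (fun k => r k w)} ->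
  (0 < n)%N ->
  eq_in_law P (fun w => antitranspose (tile_matrix n (fun k => r k w)))
              (fun w => tile_matrix n (fun k => r k w)).
Proof. by move=> pp lab _ E; exact: (tile_matrix_reversible pp lab). Qed.
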